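(* Let $E$ be a finite set and $V\subseteq \mathrm{GF}(2)^E$ a linear subspace. Given any basis of $V$, the value $T_{M(V)}(-\iota,\iota)$ can be computed in $O(\dim(V)^2|E|)$ time.
   Context: $\iota$ is the imaginary unit. For $v\in\mathrm{GF}(2)^E$, $\mathrm{supp}(v)=\{e: v_e\neq0\}$. $M(V)$ is the matroid on $E$ whose independent sets are the $F\subseteq E$ such that no nonzero $v\in V$ has $\mathrm{supp}(v)\subseteq F$. The Tutte polynomial of a matroid $M$ on $E$ with rank function $r$ is $T_M(x,y)=\sum_{F\subseteq E}(x-1)^{r(E)-r(F)}(y-1)^{|F|-r(F)}$. Computing the value means determining whether it is $0$ and otherwise the quantities (integers $|E|$, $r(E)$, $\dim(V\cap V^\perp)$, and an exponent modulo 8) expressing it as $e^{\pi\iota k/4}\sqrt2^{\,j}$. *)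

(* Defs.v *)
From HB Require Import structures.
From mathcomp Require Import all_boot all_order all_algebra.
From mathcomp Require Import complex.
From mathcomp Require Import reals trigo.

Set Implicit Arguments.
Unset Strict Implicit.
Unset Printing Implicit Defensive.

Import Order.TTheory GRing.Theory Num.Theory.
Local Open Scope ring_scope.

(* The regular module 'F_2^o is what makes the functions a vector space. *)
Notation binvec E := {ffun E -> ('F_2)^o}%type.

Definition supp (E : finType) (v : binvec E) : {set E} := [set e | v e != 0].

Definition bdot (E : finType) (u v : binvec E) : ('F_2)^o :=
  \sum_(e : E) (u e : 'F_2) * (v e : 'F_2).

Fact bdot_is_linear (E : finType) (u : binvec E) : linear (bdot u).
Proof.
move=> a v w; rewrite /bdot scaler_sumr -big_split /=.
by apply: eq_bigr => e _; rewrite !ffunE mulrDr; congr (_ + _); rewrite mulrCA.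
Qed.

HB.instance Definition _ (E : finType) (u : binvec E) :=
  GRing.isLinear.Build 'F_2 (binvec E) ('F_2)^o _ (bdot u) (bdot_is_linear u).

Definition orthov (E : finType) (V : {vspace binvec E}) : {vspace binvec E} :=
  (\bigcap_(v : binvec E | v \in V) lker (linfun (bdot v)))%VS.

Lemma orthovP (E : finType) (V : {vspace binvec E}) (u : binvec E) :
  reflect (forall v, v \in V -> bdot v u = 0) (u \in orthov V).
Proof.
rewrite /orthov memvE; apply: (iffP subv_bigcapP) => H v vV.
  by have := H v vV; rewrite -memvE memv_ker lfunE => /eqP.
by rewrite -memvE memv_ker lfunE /= H.
Qed.

Record matroid (E : finType) := Matroid {
  indep : pred {set E};
  indep0 : indep set0;
  indepS : forall F G : {set E}, F \subset G -> indep G -> indep F;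
  indepU : forall F G : {set E}, indep F -> indep G -> (#|F| < #|G|)%N ->
    exists2 e, e \in G :\: F & indep (e |: F)
}.

Definition rank (E : finType) (M : matroid E) (F : {set E}) : nat :=
  (\max_(I : {set E} | indep M I && (I \subset F)) #|I|)%N.

Definition tutte (E : finType) (M : matroid E) (K : comNzRingType) (x y : K) : K :=
  \sum_(F : {set E})
    (x - 1) ^+ (rank M [set: E] - rank M F) * (y - 1) ^+ (#|F| - rank M F).

Definition space_indep (E : finType) (V : {vspace binvec E}) : pred {set E} :=
  fun F => ~~ [exists v : binvec E, [&& v \in V, v != 0 & supp v \subset F]].

Section SpaceMatroid.
Variables (E : finType) (V : {vspace binvec E}).
Implicit Types (F G : {set E}) (v : binvec E).

Lemma space_indepP F :
  reflect (forall v, v \in V -> supp v \subset F -> v = 0) (space_indep V F).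
Proof.
rewrite /space_indep; apply: (iffP existsPn) => H v.
  by move=> vV vF; have := H v; rewrite vV vF andbT /= negbK => /eqP.
by apply/and3P => -[vV v0 vF]; rewrite (H v vV vF) eqxx in v0.
Qed.

Fact space_indep0 : space_indep V set0.
Proof.
apply/space_indepP => v _; rewrite subset0 => /eqP v0.
by apply/ffunP => e; have /setP/(_ e) := v0; rewrite !inE ffunE => /negbFE/eqP.
Qed.

Fact space_indepS F G : F \subset G -> space_indep V G -> space_indep V F.
Proof.
move=> FG /space_indepP H; apply/space_indepP => v vV vF.
by apply: H => //; apply: subset_trans vF FG.
Qed.

Lemma F2_eq (a b : 'F_2) : (a != 0) = (b != 0) -> a = b.
Proof. by case: a b => [[|[|a]] ?] [[|[|b]] ?] //= _; apply: val_inj. Qed.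

Fact space_indepU F G : space_indep V F -> space_indep V G ->
  (#|F| < #|G|)%N -> exists2 e, e \in G :\: F & space_indep V (e |: F).
Proof.
move=> /space_indepP iF /space_indepP iG ltFG; apply/exists_inP.
apply: contraLR ltFG => /exists_inPn H; rewrite -leqNgt.
have {}H e : exists v : binvec E, (e \in G :\: F) ==>
    [&& v \in V, supp v \subset e |: F & v e == 1].
  case eGF: (e \in G :\: F); last by exists 0.
  have := H e eGF; rewrite negbK => /existsP[v /and3P[vV v0 vF]].
  exists v; rewrite vV vF /=; apply/eqP/F2_eq; rewrite oner_eq0 /=.
  apply: contraNneq v0 => ve; apply/eqP/iF => //; apply/subsetP => x xv.
  have := subsetP vF x xv; rewrite !inE; case: eqP => [xe|//].
  by move: xv; rewrite xe inE ve eqxx.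
pose f e := xchoose (H e).
have fP e : e \in G :\: F -> [/\ f e \in V, supp (f e) \subset e |: F & f e e = 1].
  by move=> /(implyP (xchooseP (H e)))/and3P[? ? /eqP].
pose s (A : {set E}) : binvec E := \sum_(e in A) f e.
have sE (A : {set E}) e : A \subset G :\: F -> e \in G :\: F ->
    s A e = (e \in A)%:R.
  move=> AGF eGF; rewrite sum_ffunE.
  have z x : x \in A -> x != e -> f x e = 0.
    move=> xA xe; have [_ /subsetP/(_ e) + _] := fP x (subsetP AGF x xA).
    move: eGF; rewrite !inE [e == x]eq_sym (negbTE xe) /= => /andP[/negbTE-> _].
    by case: eqP => // _ /(_ isT).
  case: (boolP (e \in A)) => eA /=.
    rewrite (bigD1 e) //= big1 ?addr0; first by have [] := fP e eGF.
    by move=> x /andP[]; apply: z.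
  by rewrite big1 // => x xA; apply: z => //; apply: contraNneq eA => <-.
have sV (A : {set E}) : A \subset G :\: F -> s A \in V.
  move=> /subsetP AGF; apply: rpred_sum => e eA.
  by have [] := fP e (AGF e eA).
have sS (A : {set E}) e : A \subset G :\: F -> e \notin F :|: G -> s A e = 0.
  move=> /subsetP AGF eFG; rewrite sum_ffunE big1 // => x xA.
  have [_ /subsetP/(_ e) + _] := fP x (AGF x xA).
  have := AGF x xA; move: eFG; rewrite !inE negb_or => /andP[/negbTE eF eG].
  case/andP=> _ xG; rewrite eF orbF; case: eqP => // _ /(_ isT) /eqP ex.
  by rewrite ex xG in eG.
have inj : {in powerset (G :\: F) &, injective (fun A => supp (s A) :&: (F :\: G))}.
  move=> A B; rewrite !powersetE => AGF BGF sAB.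
  have : s A - s B = 0.
    apply: iG; first by rewrite rpredB ?sV.
    apply/subsetP => e; rewrite inE !ffunE; apply: contraR => eG.
    case: (boolP (e \in F)) => eF; last first.
      by rewrite !sS ?inE ?(negbTE eF) // subrr.
    rewrite subr_eq0; apply/eqP/F2_eq.
    by have /setP/(_ e) := sAB; rewrite !inE eF eG !andbT.
  move/eqP; rewrite subr_eq0 => /eqP eqs; apply/setP => e.
  case: (boolP (e \in G :\: F)) => eGF.
    have := sE A e AGF eGF; rewrite eqs (sE B e BGF eGF).
    by case: (e \in A); case: (e \in B).
  by rewrite (contraNF (subsetP AGF e) eGF) (contraNF (subsetP BGF e) eGF).
have : (#|powerset (G :\: F)| <= #|powerset (F :\: G)|)%N.
  rewrite -(card_in_imset inj) subset_leq_card //.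
  by apply/subsetP => _ /imsetP[A _ ->]; rewrite powersetE subsetIr.
rewrite !card_powerset leq_exp2l // => leGF.
by rewrite -(cardsID F G) -(cardsID G F) setIC leq_add2l.
Qed.

Definition space_matroid : matroid E :=
  Matroid space_indep0 space_indepS space_indepU.

End SpaceMatroid.

Definition expi (R : realType) (t : R) : R[i] := (cos t +i* sin t)%C.

Definition sqrt2 (R : realType) : R[i] := (Num.sqrt (2 : R))%:C%C.

Definition tutte_value (R : realType) (E : finType) (V : {vspace binvec E}) : R[i] :=
  tutte (space_matroid V) (- 'i%C) 'i%C.

(* Programs for a word RAM with w-bit words: every value and every address is
   reduced modulo 2 ^ w, and the memory consists of the cells 0, ..., 2 ^ w - 1.
   Every operation on words costs one time unit. The program is a finite object
   that is independent of the word size. *)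

Local Open Scope nat_scope.

Inductive binop := OAdd | OSub | OMul | ODiv | OMod | OEq | OLt.

Inductive expr :=
  | Const of nat
  | Reg of nat
  | Mem of expr                     (* Mem a: the cell at address a *)
  | Op of binop & expr & expr.

Inductive cmd :=
  | Skip
  | Assign of nat & expr
  | Store of expr & expr            (* Store a e: the cell at address a gets e *)
  | Seq of cmd & cmd
  | If of expr & cmd & cmd
  | While of expr & cmd.

Record state := State { reg : nat -> nat; mem : nat -> nat }.

Definition upd (f : nat -> nat) (x v : nat) : nat -> nat :=
  fun y => if y == x then v else f y.

Definition set_reg s x v := State (upd (reg s) x v) (mem s).
Definition set_mem s a v := State (reg s) (upd (mem s) a v).

(* Subtraction is truncated at 0; division by 0 yields quotient 0. *)
Definition binop_fun (o : binop) (a b : nat) : nat :=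
  match o with
  | OAdd => a + b
  | OSub => a - b
  | OMul => a * b
  | ODiv => a %/ b
  | OMod => a %% b
  | OEq => a == b
  | OLt => a < b
  end.

Fixpoint eval (w : nat) (s : state) (e : expr) : nat :=
  match e with
  | Const k => k %% 2 ^ w
  | Reg x => reg s x
  | Mem a => mem s (eval w s a)
  | Op o e1 e2 => binop_fun o (eval w s e1) (eval w s e2) %% 2 ^ w
  end.

Fixpoint ecost (e : expr) : nat :=
  match e with
  | Const _ | Reg _ => 1
  | Mem a => (ecost a).+1
  | Op _ e1 e2 => (ecost e1 + ecost e2).+1
  end.

(* exec w c s s' t : on w-bit words, c started in s halts in s' after time t. *)
Inductive exec (w : nat) : cmd -> state -> state -> nat -> Prop :=
  | exec_skip s : exec w Skip s s 1
  | exec_assign x e s :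
      exec w (Assign x e) s (set_reg s x (eval w s e)) (ecost e).+1
  | exec_store a e s :
      exec w (Store a e) s (set_mem s (eval w s a) (eval w s e))
        (ecost a + ecost e).+1
  | exec_seq c1 c2 s s1 s2 t1 t2 :
      exec w c1 s s1 t1 -> exec w c2 s1 s2 t2 ->
      exec w (Seq c1 c2) s s2 (t1 + t2)
  | exec_if e c1 c2 s s' t :
      exec w (if eval w s e != 0 then c1 else c2) s s' t ->
      exec w (If e c1 c2) s s' (ecost e + t).+1
  | exec_while_end e c s :
      eval w s e = 0 -> exec w (While e c) s s (ecost e).+1
  | exec_while e c s s1 s2 t1 t2 :
      eval w s e != 0 -> exec w c s s1 t1 -> exec w (While e c) s1 s2 t2 ->
      exec w (While e c) s s2 (ecost e + t1 + t2).+1.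

Lemma exec_det w c s s1 t1 s2 t2 :
  exec w c s s1 t1 -> exec w c s s2 t2 -> s1 = s2 /\ t1 = t2.
Proof.
have seqE c1 c2 r r2 t : exec w (Seq c1 c2) r r2 t -> exists r1 u1 u2,
    [/\ exec w c1 r r1 u1, exec w c2 r1 r2 u2 & t = u1 + u2].
  by move=> H; inversion H; subst; do 3!eexists; split; eauto.
have ifE e c1 c2 r r2 t : exec w (If e c1 c2) r r2 t -> exists2 u,
    exec w (if eval w r e != 0 then c1 else c2) r r2 u & t = (ecost e + u).+1.
  by move=> H; inversion H; subst; eexists; eauto.
have whileE e d r r2 t : exec w (While e d) r r2 t ->
    if eval w r e == 0 then r2 = r /\ t = (ecost e).+1 else
    exists r1 u1 u2, [/\ exec w d r r1 u1, exec w (While e d) r1 r2 u2 &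
      t = (ecost e + u1 + u2).+1].
  move=> H; inversion H as [| | | | | ? ? ? e0 | ? ? ? ? ? ? ? e0]; subst.
    by rewrite e0.
  by rewrite (negbTE e0); do 3!eexists; split; eauto.
move=> H; elim: H s2 t2 => {c s s1 t1}.
- by move=> s s2 t2 H; inversion H.
- by move=> x e s s2 t2 H; inversion H.
- by move=> a e s s2 t2 H; inversion H.
- move=> c1 c2 s s1 s2 t1 t2 _ IH1 _ IH2 s3 t3 /seqE[r [u1 [u2 [E1 E2 ->]]]].
  by move: E1 E2 => /IH1[<- <-] /IH2[<- <-].
- by move=> e c1 c2 s s' t _ IH s2 t2 /ifE[u /IH[<- <-] ->].
- by move=> e c s e0 s2 t2 /whileE; rewrite e0 => -[-> ->].
- move=> e c s s1 s2 t1 t2 /negbTE e0 _ IH1 _ IH2 s3 t3 /whileE.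
  rewrite e0 => -[r [u1 [u2 [E1 E2 ->]]]].
  by move: E1 E2 => /IH1[<- <-] /IH2[<- <-].
Qed.

(* The number of vectors is in register 0 and |E| in register 1; the memory
   starts with the 0/1 matrix whose rows are the vectors, in row-major order.
   All other registers and cells are 0. *)
Definition input (E : finType) (b : seq (binvec E)) : state :=
  State (fun x => nth 0 [:: size b; #|E|] x)
        (fun a => nth 0 [seq nat_of_bool (v e != 0%R) | v : binvec E <- b, e : E <- enum E] a).

(* Register 0 tells whether z is nonzero; if it is, registers 1, ..., 5 hold
   |E|, r(E), the dimension of the intersection of V with its orthogonal space,
   and the exponents k (modulo 8) and j. *)
Definition output_value (R : realType) (E : finType) (V : {vspace binvec E})
    (z : R[i]) (s : state) : Prop :=
  reg s 0 = (z != 0%R) /\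
  (z <> 0%R ->
   [/\ reg s 1 = #|E|,
       reg s 2 = rank (space_matroid V) [set: E],
       reg s 3 = \dim (V :&: orthov V),
       reg s 4 < 8 &
       z = (expi (pi * (reg s 4)%:R / 4) * sqrt2 R ^+ reg s 5)%R]).

(* Main.v *)
Require Import Defs.
From HB Require Import structures.
From mathcomp Require Import all_boot all_order all_algebra.
From mathcomp Require Import complex.
From mathcomp Require Import reals trigo.
From mathcomp Require Import ring lra zify.

(** On the hyperbola (x-1)(y-1) = 2 the Tutte polynomial of M(V) is, up to a
power of x-1, the weight enumerator of V; at (-i, i) this gives
T (-1-i)^(dim V) = (-i)^|E| S with S the sum of i^wt(v) over v in V.
The Gauss sum S is evaluated by orthogonal elimination on the rows of a basis:
a vector v of odd weight splits off a factor 1 + i^wt(v), a vector of even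
weight orthogonal to all rows splits off 1 + i^wt(v), which is 2 or 0, and two
non-orthogonal vectors v, u with wt(v) even split off a nondegenerate plane, which
contributes 2 if wt(v) = 0 and 2 i^wt(u) if wt(v) = 2 modulo 4. Each of the
dim V steps takes O(dim V) operations on rows of length |E|. The exponent of
sqrt 2 need not be followed through the elimination to identify it with
dim (V cap V^perp): this follows from |S|^2 = 2^(dim V + dim (V cap V^perp)),
valid whenever S is nonzero. *)

Set Implicit Arguments.
Unset Strict Implicit.
Unset Printing Implicit Defensive.

Import Order.TTheory GRing.Theory Num.Theory.
Local Open Scope ring_scope.

(** * Binary vectors and the elimination of rows *)

Definition wt (E : finType) (v : binvec E) : nat := #|supp v|.

Definition ndot (E : finType) (u v : binvec E) : nat := #|supp u :&: supp v|.

Section BinaryVectors.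
Variable E : finType.
Implicit Types u v w : binvec E.

Lemma F2_natr_eq0 (n : nat) : ((n%:R : 'F_2) == 0) = ~~ odd n.
Proof. by rewrite -(dvdn_pcharf (pchar_Fp (isT : prime 2))) dvdn2. Qed.

Lemma F2_addrr (x : 'F_2) : x + x = 0.
Proof. by case: x => -[|[|k]] // ltk; apply: val_inj. Qed.

Lemma F2_natr (x : 'F_2) : x = (x != 0)%:R.
Proof. by case: x => -[|[|k]] // ltk; apply: val_inj. Qed.

Lemma addvv v : v + v = 0.
Proof. by apply/ffunP => e; rewrite !ffunE; apply: F2_addrr. Qed.

Lemma addvK u v : u + v + v = u.
Proof. by rewrite -addrA addvv addr0. Qed.

Lemma supp0 : supp (0 : binvec E) = set0.
Proof. by apply/setP => e; rewrite !inE ffunE eqxx. Qed.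

Lemma wt0 : wt (0 : binvec E) = 0%N.
Proof. by rewrite /wt supp0 cards0. Qed.

Lemma ndot0v v : ndot 0 v = 0%N.
Proof. by rewrite /ndot supp0 set0I cards0. Qed.

Lemma ndot_diag v : ndot v v = wt v.
Proof. by rewrite /ndot setIid. Qed.

Lemma ndotC u v : ndot u v = ndot v u.
Proof. by rewrite /ndot setIC. Qed.

Lemma suppD u v : supp (u + v) = (supp u :\: supp v) :|: (supp v :\: supp u).
Proof.
apply/setP => e; rewrite !inE ffunE.
by move: (u e) (v e) => [[|[|a]] ?] [[|[|b]] ?].
Qed.

(** Coordinates common to both supports cancel in the sum but are counted twice on the right. *)
Lemma wtD u v : (wt (u + v)%R + (ndot u v).*2 = wt u + wt v)%N.
Proof.
rewrite /wt /ndot suppD cardsU.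
rewrite (_ : (_ :\: _) :&: (_ :\: _) = set0) ?cards0; last first.
  by apply/setP => e; rewrite !inE; case: (u e != 0); case: (v e != 0).
rewrite -(cardsID (supp v) (supp u)) -(cardsID (supp u) (supp v)) setIC; lia.
Qed.

Lemma bdot_ndot u v : bdot u v = (ndot u v)%:R.
Proof.
rewrite /bdot /ndot -sum1_card natr_sum [RHS]big_mkcond /=.
apply: eq_bigr => e _; rewrite !inE.
by move: (u e) (v e) => [[|[|a]] ?] [[|[|b]] ?] //; apply: val_inj.
Qed.

Lemma bdot_eq0 u v : (bdot u v == 0) = ~~ odd (ndot u v).
Proof. by rewrite bdot_ndot F2_natr_eq0. Qed.

(** Modulo 2, [ndot] is the bilinear form [bdot]. *)
Lemma ndot_odd_Dl u v w :
  odd (ndot (u + v) w) = odd (ndot u w) (+) odd (ndot v w).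
Proof.
have oddE n : odd n = ((n%:R : 'F_2) != 0) by rewrite F2_natr_eq0 negbK.
rewrite !(ndotC _ w) !oddE -!bdot_ndot linearD /=.
by move: (bdot w u) (bdot w v) => [[|[|a]] ?] [[|[|b]] ?].
Qed.

End BinaryVectors.

(* The rows f may be dependent: vectors of the span count with multiplicity. *)
Fixpoint comb_sum (K : nmodType) (E : finType) (m : nat) (f : nat -> binvec E)
    (F : binvec E -> K) (w : binvec E) : K :=
  if m is m'.+1 then comb_sum m' f F w + comb_sum m' f F (w + f m') else F w.

(** * Sums over all combinations of given rows *)

Section CombSum.
Variables (K : nmodType) (E : finType).
Implicit Types (f g : nat -> binvec E) (F H : binvec E -> K) (v w : binvec E).

Lemma eq_comb_sum m f g F w : (forall x, (x < m)%N -> f x = g x) ->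
  comb_sum m f F w = comb_sum m g F w.
Proof.
elim: m w => [|m IH] w fg //=.
by rewrite fg // !IH // => x xm; apply: fg; apply: ltnW.
Qed.

Lemma comb_sum_shift m f F v w :
  comb_sum m f F (w + v) = comb_sum m f (fun y => F (y + v)) w.
Proof. by elim: m w => [|m IH] w //=; rewrite -!IH addrAC. Qed.

Lemma comb_sumD m f F H w :
  comb_sum m f (fun y => F y + H y) w = comb_sum m f F w + comb_sum m f H w.
Proof. by elim: m w => [|m IH] w //=; rewrite !IH addrACA. Qed.

(** Translation by a row only permutes the combinations; for the last row it swaps the two
    summands. *)
Lemma comb_sum_row m f F w j : (j < m)%N ->
  comb_sum m f F (w + f j) = comb_sum m f F w.
Proof.
elim: m w => [|m IH] w //=; rewrite ltnS leq_eqVlt => /orP[/eqP->|jm].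
  by rewrite addvK addrC.
by rewrite [w + f j + _]addrAC !IH.
Qed.

(** [P] confines the comparison to the points where the sum evaluates [F]; it will be orthogonality
    to the vectors that are split off. *)
Lemma comb_sum_ext m f F H w (P : binvec E -> Prop) : P w ->
  (forall y x, (x < m)%N -> P y -> P (y + f x)) -> (forall y, P y -> F y = H y) ->
  comb_sum m f F w = comb_sum m f H w.
Proof.
move=> + + FH; elim: m w => [|m IH] w Pw Pf /=; first exact: FH.
by rewrite !IH //; try (by move=> y x xm; apply: Pf; apply: ltnW); apply: Pf.
Qed.

(** Rows may be changed by a period [v] of [F]: this is what permits elimination inside the sum. *)
Lemma comb_sum_inv m f g F v w : (forall y, F (y + v) = F y) ->
  (forall x, (x < m)%N -> g x = f x \/ g x = f x + v) ->
  comb_sum m f F w = comb_sum m g F w.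
Proof.
move=> Fv; elim: m w => [|m IH] w fg //=.
have {}IH y : comb_sum m f F y = comb_sum m g F y.
  by apply: IH => x xm; apply: fg; apply: ltnW.
rewrite !IH; case: (fg m (ltnSn m)) => -> //; rewrite addrA (comb_sum_shift _ _ _ v).
congr (_ + _).
by rewrite (@comb_sum_ext m g (fun y => F (y + v)) F _ (fun=> True)).
Qed.

(** Freeness keeps [v] outside the span of [l], so the larger span is the disjoint union of that
    span and its translate by [v]. *)
Lemma sum_span_rcons (l : seq (binvec E)) v F w : free (rcons l v) ->
  \sum_(y in <<rcons l v>>%VS) F (w + y) =
  \sum_(y in <<l>>%VS) F (w + y) + \sum_(y in <<l>>%VS) F (w + v + y).
Proof.
have [perm_l eq_l] : perm_eq (rcons l v) (v :: l) /\ rcons l v =i v :: l.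
  by split; [rewrite perm_rcons | apply: mem_rcons].
rewrite (perm_free perm_l) (eq_span eq_l) free_cons => /andP[vl _].
rewrite (bigID (fun y => y \in <<l>>%VS)) /=; congr (_ + _).
  apply: eq_bigl => y; case: (boolP (y \in <<l>>%VS)) => yl; rewrite ?andbF ?andbT //.
  by rewrite span_cons (subvP (addvSr _ _)).
rewrite (reindex_inj (addrI v)) /=; apply: eq_big => [y|y _]; last by rewrite addrA.
apply/andP/idP => [[]|yl].
  rewrite span_cons => /memv_addP[a /vlineP[k ->] [z zl eq_vy]] vyl.
  (* The coefficient [k] is 0 or 1, and 0 would put [v + y] into the span of [l]. *)
  have: k *: v + z = z \/ k *: v + z = v + z.
    by move: k {eq_vy} => [[|[|k]] ltk] //; [left|right];
       [rewrite (_ : Ordinal _ = 0) ?scale0r ?add0r | rewrite (_ : Ordinal _ = 1) ?scale1r];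
       rewrite //; apply: val_inj.
  rewrite -eq_vy => -[eq_z|/addrI-> //].
  by rewrite eq_z zl in vyl.
split; first by rewrite span_cons memv_add ?memv_line.
by apply: contra vl => vyl; rewrite -(addvK v y) rpredD.
Qed.

Lemma comb_sum_span (l : seq (binvec E)) F w : free l ->
  comb_sum (size l) (nth 0 l) F w = \sum_(y in <<l>>%VS) F (w + y).
Proof.
elim/last_ind: l w => [|l v IH] w frl.
  rewrite /= (big_pred1 (0 : binvec E)) ?addr0 // => y.
  by rewrite span_nil memv0.
rewrite sum_span_rcons // size_rcons /=.
have frl' : free l by move: frl; rewrite -cats1 => /catl_free.
rewrite -!IH // nth_rcons ltnn eqxx.
by congr (_ + _); apply: eq_comb_sum => x xl; rewrite nth_rcons xl.
Qed.

End CombSum.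

Lemma card_span (E : finType) (V : {vspace binvec E}) :
  #|[set v : binvec E | v \in V]| = (2 ^ \dim V)%N.
Proof.
have [b_span b_free] := andP (vbasisP V).
have count m f (w : binvec E) : comb_sum m f (fun=> 1%N) w = (2 ^ m)%N.
  by elim: m w => [|m IH] w //=; rewrite !IH expnS mul2n -addnn.
have := count (size (vbasis V)) (nth 0 (vbasis V)) 0.
rewrite comb_sum_span // (eqP b_span) size_tuple => <-.
by rewrite -sum1_card; apply: eq_bigl => v; rewrite inE.
Qed.

(** Orthogonalization against the plane of [v] and [u], for [v] of even weight and [ndot v u] odd:
    adding [u] corrects the product with [v], and adding [v] then corrects the product with [u]
    without disturbing the first. For [u = v] of odd weight the first addition suffices and the
    second never occurs. *)
Definition eliminate (E : finType) (v u y : binvec E) : binvec E :=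
  let z := if odd (ndot y v) then y + u else y in
  if odd (ndot z u) then z + v else z.

Section Elimination.
Variables (K : idomainType) (iota : K) (E : finType).
Hypothesis iota2 : iota ^+ 2 = -1.
Implicit Types (f g : nat -> binvec E) (u v w y : binvec E).

Definition iwt v : K := iota ^+ wt v.

(** By [wtD], each common coordinate costs a factor [iota ^ 2 = -1]; thus [iwt] is multiplicative on
    orthogonal pairs. *)
Lemma iwtD u v : iwt (u + v) = iwt u * iwt v * (-1) ^+ odd (ndot u v).
Proof.
rewrite /iwt -exprD -wtD exprD -muln2 mulnC exprM iota2 signr_odd -mulrA -expr2.
by rewrite sqrr_sign mulr1.
Qed.

Lemma comb_sumZ m f c w : comb_sum m f (fun y => c * iwt y) w = c * comb_sum m f iwt w.
Proof. by elim: m w => [|m IH] w //=; rewrite !IH mulrDr. Qed.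

Lemma elim_orthogonal v u y : odd (ndot v u) -> ~~ odd (wt v) ->
  ~~ odd (ndot (eliminate v u y) v) /\ ~~ odd (ndot (eliminate v u y) u).
Proof.
move=> vu wv; rewrite /eliminate /=.
have uv : odd (ndot u v) by rewrite ndotC.
case yv: (odd (ndot y v)); case yu: (odd (ndot y u)); case wu: (odd (wt u));
  by do 4! rewrite ?(ndot_odd_Dl, ndot_diag, uv, vu, yv, yu, wu, negbTE wv) /=.
Qed.

Lemma elim_odd_orthogonal v y : odd (wt v) -> ~~ odd (ndot (eliminate v v y) v).
Proof.
move=> wv; rewrite /eliminate /=.
by case yv: (odd (ndot y v)); do 3! rewrite ?(ndot_odd_Dl, ndot_diag, wv, yv) /=.
Qed.

Lemma comb_sum_split m f : comb_sum m.+1 f iwt 0 =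
  comb_sum m f (fun y => iwt y + iwt (y + f m)) 0.
Proof. by rewrite comb_sumD /= comb_sum_shift. Qed.

Lemma comb_sum_radical m f : (forall x, (x < m)%N -> ~~ odd (ndot (f x) (f m))) ->
  comb_sum m.+1 f iwt 0 = (1 + iwt (f m)) * comb_sum m f iwt 0.
Proof.
move=> orth; rewrite comb_sum_split -comb_sumZ.
apply: (@comb_sum_ext _ _ m f _ _ _ (fun y => ~~ odd (ndot y (f m)))).
- by rewrite !ndot0v.
- by move=> y x xm /negbTE yo; rewrite ndot_odd_Dl yo; apply: orth.
- by move=> y /negbTE yo; rewrite iwtD yo mulr1 mulrDl mul1r mulrC.
Qed.

(** The sum of [iwt] over a coset of the line through [f m] has period [f m], so the other rows can
    be made orthogonal to [f m] first; then the factor splits off as in the radical case. *)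
Lemma comb_sum_odd m f g : odd (wt (f m)) ->
  (forall x, (x < m)%N -> g x = eliminate (f m) (f m) (f x)) ->
  comb_sum m.+1 f iwt 0 = (1 + iwt (f m)) * comb_sum m g iwt 0.
Proof.
move=> wo gE; have orth x : (x < m)%N -> ~~ odd (ndot (g x) (f m)).
  by move=> xm; rewrite gE //; apply: elim_odd_orthogonal.
rewrite comb_sum_split (@comb_sum_inv _ _ m f g _ (f m)).
- rewrite -comb_sumZ.
  apply: (@comb_sum_ext _ _ m g _ _ _ (fun y => ~~ odd (ndot y (f m)))).
  + by rewrite !ndot0v.
  + by move=> y x xm /negbTE yo; rewrite ndot_odd_Dl yo; apply: orth.
  + by move=> y /negbTE yo; rewrite iwtD yo mulr1 mulrDl mul1r mulrC.
- by move=> y; rewrite addvK addrC.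
- move=> x xm; rewrite gE // /eliminate /=; case: ifP => yv; case: ifP => //; auto.
  by rewrite addvK; auto.
Qed.

(* The factor 2 accounts for row j, which elimination turns into 0. *)
Lemma comb_sum_hyperbolic m f g j : (j < m)%N ->
  ~~ odd (wt (f m)) -> odd (ndot (f m) (f j)) ->
  (forall x, (x < m)%N -> g x = eliminate (f m) (f j) (f x)) ->
  2 * comb_sum m.+1 f iwt 0 =
  (1 + iwt (f m) + iwt (f j) - iwt (f m) * iwt (f j)) * comb_sum m g iwt 0.
Proof.
set v := f m; set u := f j => jm wv vu gE.
have orth x : (x < m)%N -> ~~ odd (ndot (g x) v) /\ ~~ odd (ndot (g x) u).
  by move=> xm; rewrite gE //; apply: elim_orthogonal.
pose H y := iwt y + iwt (y + v); pose H2 y := H y + H (y + u).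
have Hv y : H (y + v) = H y by rewrite /H addvK addrC.
have H2u y : H2 (y + u) = H2 y by rewrite /H2 addvK addrC.
have H2v y : H2 (y + v) = H2 y by rewrite /H2 (addrAC y) !Hv.
(* As [u] is itself a row, the sum of [H] equals that of its translate by [u]; together they give
   [H2], which has both periods [u] and [v]. *)
have -> : 2 * comb_sum m.+1 f iwt 0 = comb_sum m f H2 0.
  rewrite comb_sum_split mulr_natl mulr2n.
  rewrite -{2}(comb_sum_row f (fun y => iwt y + iwt (y + f m)) 0 jm) comb_sum_shift.
  by rewrite -comb_sumD.
(* The two additions in [eliminate] change rows by [u] and then by [v], both periods of [H2]. *)
pose g1 x := if odd (ndot (f x) v) then f x + u else f x.
rewrite (@comb_sum_inv _ _ m f g1 _ u) //; last first.
  by move=> x _; rewrite /g1; case: ifP; auto.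
rewrite (@comb_sum_inv _ _ m g1 g _ v) //; last first.
  by move=> x xm; rewrite gE // /eliminate -/(g1 x); case: ifP; auto.
rewrite -comb_sumZ.
apply: (@comb_sum_ext _ _ m g _ _ _
         (fun y => ~~ odd (ndot y v) /\ ~~ odd (ndot y u))).
- by rewrite !ndot0v.
- move=> y x xm [/negbTE yv /negbTE yu]; rewrite !ndot_odd_Dl yv yu.
  exact: orth.
(* The minus sign in the factor comes from the term of [u + v], since [ndot u v] is odd. *)
- move=> y [/negbTE yv /negbTE yu]; rewrite /H2 /H !iwtD ndot_odd_Dl yv yu.
  rewrite (ndotC u) vu /=; ring.
Qed.

End Elimination.

Arguments iwt {K} iota {E} v.

(** * The Tutte value as a Gauss sum *)

Section TutteWeight.
Variables (E : finType) (V : {vspace binvec E}).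
Implicit Types (F G : {set E}) (v : binvec E).

Definition vectors_in F : {set binvec E} := [set v | (v \in V) && (supp v \subset F)].

Let M := space_matroid V.

Lemma rank_leq F : (rank M F <= #|F|)%N.
Proof. by apply/bigmax_leqP => I /andP[_ /subset_leq_card]. Qed.

Lemma rankS F G : F \subset G -> (rank M F <= rank M G)%N.
Proof.
move=> FG; apply/bigmax_leqP => I /andP[iI IF].
by apply: (@leq_bigmax_cond _ _ (fun I : {set E} => #|I|)); rewrite iI (subset_trans IF).
Qed.

(** Induction on the size of [F]. If [F] is dependent, pick [e] in the support of a nonzero vector
    [v] of [V] supported in [F]. The vectors supported in [F :\ e] vanish at [e], their translates
    by [v] do not, so the count at least doubles when [e] is restored, and the rank does not
    drop. *)
Lemma card_vectors_in_ge F : (2 ^ #|F| <= 2 ^ rank M F * #|vectors_in F|)%N.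
Proof.
have [n leFn] := ubnP #|F|; elim: n F leFn => // n IH F /ltnSE leFn.
have [iF|] := boolP (space_indep V F).
  rewrite (leq_trans (n := 2 ^ rank M F)) ?leq_pexp2l //.
    by apply: (@leq_bigmax_cond _ _ (fun I : {set E} => #|I|)); rewrite /= iF subxx.
  rewrite leq_pmulr // card_gt0; apply/set0Pn; exists 0.
  by rewrite inE mem0v supp0 sub0set.
rewrite negbK => /existsP[v /and3P[vV v0 vF]].
have [e ev] : exists e, e \in supp v.
  apply/set0Pn; apply: contra v0 => /eqP/setP v0; apply/eqP/ffunP => e.
  by have := v0 e; rewrite !inE ffunE => /negbFE/eqP.
have eF := subsetP vF e ev.
have cardF := cardsD1 e F; rewrite eF /= add1n in cardF.
have {}IH := IH (F :\ e) _; rewrite cardF expnS.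
have /IH {}IH : (#|F :\ e| < n)%N by rewrite -cardF.
apply: (@leq_trans (2 * (2 ^ rank M (F :\ e) * #|vectors_in (F :\ e)|)));
    first by rewrite leq_mul2l IH.
rewrite mulnCA leq_mul ?leq_pexp2l ?rankS ?subsetDl //.
set A := vectors_in _; pose B := [set v + y | y in A].
have cardB : #|B| = #|A| by rewrite card_imset //; apply: addrI.
have AB0 : A :&: B = set0.
  apply/setP => y; rewrite !inE; apply/negP => /andP[/andP[_ ye]].
  case/imsetP => z; rewrite inE => /andP[_ /subsetP/(_ e)] ze yE.
  move: ze (subsetP ye e); rewrite yE !inE eqxx ffunE /= => ze.
  have -> : z e = 0 by apply/eqP/negPn/negP => /ze.
  by move: ev; rewrite inE addr0 => -> /(_ isT).
rewrite mul2n -addnn -{2}cardB (_ : (#|A| + #|B| = #|A :|: B|)%N); last first.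
  by rewrite cardsU AB0 cards0 subn0.
apply: subset_leq_card; rewrite subUset; apply/andP; split.
  by apply/subsetP => y; rewrite !inE => /andP[-> /subset_trans->] //; apply: subsetDl.
apply/subsetP => _ /imsetP[y + ->]; rewrite !inE => /andP[yV yF].
rewrite rpredD //= suppD subUset !subDset; apply/andP; split.
  by rewrite (subset_trans vF) ?subsetUr.
by rewrite (subset_trans yF) // (subset_trans (subsetDl _ _)) ?subsetUr.
Qed.

(** For a largest independent [I] in [F], a vector supported in [F] is determined by its support
    outside [I]: two vectors agreeing there have a sum supported in [I], hence zero. *)
Lemma card_vectors_in_le F : (2 ^ rank M F * #|vectors_in F| <= 2 ^ #|F|)%N.
Proof.
have [I iI ->] : {I : {set E} | indep M I && (I \subset F) & rank M F = #|I|}.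
  by apply: eq_bigmax_cond; apply/card_gt0P; exists set0; rewrite unfold_in /= space_indep0
      sub0set.
case/andP: iI => /space_indepP iI IF.
have inj : {in vectors_in F &, injective (fun v => supp v :\: I)}.
  move=> u v; rewrite !inE => /andP[uV _] /andP[vV _] uvI.
  rewrite -(addvK u v) (iI (u + v)) ?add0r ?rpredD //.
  rewrite suppD subUset !subDset; apply/andP; split; apply/subsetP => e;
  have /setP/(_ e) := uvI; rewrite !inE; case: (e \in I); rewrite ?orbT //= => ->;
      by rewrite ?orbF.
rewrite -(cardsID I F) (setIidPr IF) expnD leq_pmul2l ?expn_gt0 //.
rewrite -(card_in_imset inj) -card_powerset subset_leq_card //.
apply/subsetP => _ /imsetP[v + ->]; rewrite !inE => /andP[_ vF].
exact: setSD.
Qed.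

Lemma card_vectors_in F : #|vectors_in F| = (2 ^ (#|F| - rank M F))%N.
Proof.
apply/eqP; rewrite -(eqn_pmul2l (m := 2 ^ rank M F)) ?expn_gt0 // -expnD subnKC ?rank_leq //.
by rewrite eqn_leq card_vectors_in_ge card_vectors_in_le.
Qed.

Lemma rank_setT : (rank M [set: E] + \dim V = #|E|)%N.
Proof.
have: #|vectors_in [set: E]| = (2 ^ \dim V)%N.
  by rewrite -card_span; apply: eq_card => v; rewrite !inE subsetT andbT.
rewrite card_vectors_in cardsT => /eqP; rewrite eqn_exp2l // => /eqP <-.
by rewrite subnKC // -cardsT rank_leq.
Qed.

(* On the hyperbola (x-1)(y-1) = 2, the factor 2^(|F|-r(F)) counts the vectors
   of V supported in F. *)
Lemma tutte_hyperbola (K : comNzRingType) (x y : K) : (x - 1) * (y - 1) = 2 ->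
  (x - 1) ^+ \dim V * tutte M x y = \sum_(v in V) x ^+ (#|E| - wt v).
Proof.
move=> xy2; pose X := x - 1.
have -> : (x - 1) ^+ \dim V * tutte M x y =
    \sum_(F : {set E}) \sum_(v in vectors_in F) X ^+ #|~: F|.
  rewrite /tutte mulr_sumr; apply: eq_bigr => F _.
  rewrite sumr_const card_vectors_in mulrA -exprD -mulr_natr natrX -xy2.
  have -> : (\dim V + (rank M [set: E] - rank M F) = #|~: F| + (#|F| - rank M F))%N.
    have := rank_setT; have := rank_leq F; have := rankS (subsetT F); have := cardsC F; lia.
  by rewrite exprD exprMn mulrA.
rewrite (exchange_big_dep (mem V)) /=; last by move=> F v _; rewrite inE => /andP[].
apply: eq_bigr => v vV.
(* Expanding this product by the set [F] of factors where 1 is chosen gives [X ^ #|~: F|] if [F]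
   contains the support of [v], and 0 otherwise. *)
have -> : x ^+ (#|E| - wt v) = \prod_(e : E) (1 + (if e \in supp v then 0 else X)).
  rewrite (bigID (mem (supp v))) /= big1 ?mul1r; last by move=> e ->; rewrite addr0.
  rewrite (eq_bigr (fun=> x)); last by move=> e /negbTE->; rewrite /X addrC subrK.
  rewrite prodr_const /wt -(cardsC (supp v)) addKn; congr (_ ^+ _).
  by apply: eq_card => e; rewrite inE unfold_in.
rewrite (bigA_distr 1 +%R) [LHS]big_mkcond; apply: eq_bigr => F _.
rewrite inE vV /=; case: (boolP (supp v \subset F)) => [vF|/subsetPn[e ev eF]].
  rewrite (bigID (mem F)) /= big1 ?mul1r; last by move=> e ->.
  rewrite (eq_bigr (fun=> X)); first by rewrite prodr_const; congr (_ ^+ _);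
      apply: eq_card => e; rewrite inE unfold_in.
  by move=> e /[dup] eF /negbTE->; rewrite (contraNF (subsetP vF e) eF).
by rewrite (bigD1 e) //= (negbTE eF) ev mul0r.
Qed.

End TutteWeight.

(** * The modulus of the Gauss sum *)

Section GaussSum.
Variables (K : numDomainType) (iota : K) (E : finType).
Hypothesis iota2 : iota ^+ 2 = -1.
Variable V : {vspace binvec E}.
Implicit Types (v w : binvec E).

Let rad := (V :&: Defs.orthov V)%VS.

(** Meant for [c != 1], where it forces the sum to vanish. *)
Lemma sum_translate (W : {vspace binvec E}) (F : binvec E -> K) (c : K) w :
  w \in W -> (forall v, v \in W -> F (v + w) = c * F v) ->
  c * (\sum_(v in W) F v) = \sum_(v in W) F v.
Proof.
move=> wW Fw; rewrite [RHS](reindex_inj (addIr w)) mulr_sumr /=.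
apply: eq_big => [v|v vW]; last by rewrite Fw.
by apply/idP/idP => vW; [rewrite rpredD | rewrite -(addvK v w) rpredD].
Qed.

Lemma sum_sign_dot w :
  \sum_(v in V) (-1) ^+ odd (ndot v w) =
  (if w \in Defs.orthov V then 2 ^+ \dim V else 0) :> K.
Proof.
case: (boolP (w \in Defs.orthov V)) => [/Defs.orthovP wV | wV].
  rewrite (eq_bigr (fun=> 1)); last first.
    by move=> v vV; have /eqP := wV v vV; rewrite bdot_eq0 => /negbTE->.
  by rewrite sumr_const -natrX -card_span; congr (_ %:R); apply: eq_card => v; rewrite inE.
have /existsP[v0 /andP[v0V v0w]] : [exists v, (v \in V) && odd (ndot v w)].
  apply: contraR wV => /existsPn no; apply/Defs.orthovP => v vV.
  by apply/eqP; rewrite bdot_eq0; have := no v; rewrite vV.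
have sgn v : (-1) ^+ odd (ndot (v + v0) w) = -1 * (-1) ^+ odd (ndot v w) :> K.
  by rewrite ndot_odd_Dl v0w addbT mulN1r; case: odd; rewrite ?expr0 ?expr1 ?opprK.
have := sum_translate v0V (fun v _ => sgn v).
by rewrite mulN1r => /eqP; rewrite eqNr => /eqP.
Qed.

(** By [iwtD], [iwt] is a character on the radical: its sum vanishes unless the character is
    trivial. *)
Lemma sum_iwt_rad : \sum_(v in rad) iwt iota v = 2 ^+ \dim rad \/
  \sum_(v in rad) iwt iota v = 0.
Proof.
case: (boolP [forall (v | v \in rad), iwt iota v == 1]) => [/forall_inP all1|].
  left; rewrite (eq_bigr (fun=> 1)); last by move=> v /all1/eqP.
  by rewrite sumr_const -natrX -card_span; congr (_ %:R); apply: eq_card => v; rewrite inE.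
rewrite negb_forall_in => /exists_inP[w wrad w1]; right.
have shift v : v \in rad -> iwt iota (v + w) = iwt iota w * iwt iota v.
  rewrite memv_cap => /andP[vV _].
  move: wrad; rewrite memv_cap => /andP[_ /Defs.orthovP/(_ v vV)/eqP].
  by rewrite bdot_eq0 iwtD // => /negbTE->; rewrite mulr1 mulrC.
have /eqP := sum_translate wrad shift.
rewrite -subr_eq0 -[X in _ - X]mul1r -mulrBl mulf_eq0 subr_eq0 (negbTE w1) /=.
by move/eqP.
Qed.

(** The product is a sum over pairs [v], [v + w]; summing over [v] first kills every [w] outside the
    orthogonal space. What remains is the sum over the radical, and nonvanishing selects the first
    case of [sum_iwt_rad]. *)
Lemma gauss_sum_modulus : \sum_(v in V) iwt iota v != 0 ->
  \sum_(v in V) iwt (- iota) v != 0 ->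
  (\sum_(v in V) iwt iota v) * (\sum_(v in V) iwt (- iota) v) =
  2 ^+ (\dim V + \dim rad).
Proof.
move=> S1 S2; have := mulf_neq0 S1 S2.
have -> : (\sum_(v in V) iwt iota v) * (\sum_(v in V) iwt (- iota) v) =
    2 ^+ \dim V * \sum_(v in rad) iwt iota v.
  transitivity (\sum_(v in V) \sum_(w in V) iwt iota w * (-1) ^+ odd (ndot v w)).
    rewrite mulr_sumr; apply: eq_bigr => v vV; rewrite mulr_suml.
    rewrite (reindex_inj (addrI v)) /=; apply: eq_big => [w|w _].
      by apply/idP/idP => wV; [rewrite -(addvK w v) [w + v]addrC rpredD | rewrite rpredD].
    have vv : iwt iota v * iwt (- iota) v = 1.
      by rewrite /iwt -exprMn mulrN -expr2 iota2 opprK expr1n.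
    by rewrite iwtD // -[RHS]mul1r -vv; ring.
  rewrite exchange_big /= mulr_sumr [RHS](eq_bigl (fun w => (w \in V) && (w \in Defs.orthov V))).
    rewrite big_mkcondr; apply: eq_bigr => w wV.
    by rewrite -mulr_sumr sum_sign_dot; case: ifP => _; rewrite ?mulr0 // mulrC.
  by move=> w; rewrite memv_cap.
by case: sum_iwt_rad => ->; rewrite ?mulr0 ?eqxx // exprD.
Qed.

End GaussSum.

(** * The primitive eighth root of unity and the square root of 2 *)

Section EighthRoots.
Variable R : realType.
Local Notation C := R[i].
Local Notation I := ('i%C : C).
Let s2 : C := sqrt2 R.
Let om : C := expi (pi / 4 : R).

Lemma sqrt2_sqr : s2 ^+ 2 = 2.
Proof.
rewrite /s2 /sqrt2 -rmorphXn /= sqr_sqrtr ?ler0n //.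
by rewrite rmorph_nat.
Qed.

Lemma expiD (a b : R) : expi (a + b) = expi a * expi b.
Proof.
by rewrite /expi cosD sinD; simpc; congr (_ +i* _)%C; rewrite addrC.
Qed.

Lemma expi_natmul (k : nat) : expi (pi * k%:R / 4) = om ^+ k.
Proof.
elim: k => [|k IH]; first by rewrite mulr0 mul0r /expi cos0 sin0 expr0.
by rewrite exprSr -IH -expiD -natr1; congr expi; rewrite /=; field.
Qed.

Lemma expi_pi4_sqr : om ^+ 2 = I.
Proof.
rewrite expr2 -expiD (_ : _ + _ = pi / 2); last by field.
by rewrite /expi cos_pihalf sin_pihalf.
Qed.

(** With [c] and [s] the parts of [om], [om ^ 2 = i] says [c * c = s * s] and [2 * c * s = 1];
    positivity of [c] then gives [s = c] and [sqrt 2 * c = 1]. *)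
Lemma sqrt2_expi_pi4 : s2 * om = 1 + I.
Proof.
have c_gt0 : 0 < cos (pi / 4 : R).
  have p0 := pi_gt0 R; apply: cos_gt0_pihalf; apply/andP; split; lra.
have := expi_pi4_sqr; rewrite /om /expi expr2; simpc => -[/eqP + /eqP].
set c := cos _ in c_gt0 *; set s := sin _ => e1 e2.
have {}e1 : c * c = s * s by apply/eqP; move: e1; rewrite subr_eq0.
have {}e2 : c * s + s * c = 1 by apply/eqP.
have cs : s = c.
  apply/eqP; have : (s - c) * (s + c) = 0 by rewrite mulrDr !mulrBl e1 [c * s]mulrC; ring.
  move/eqP; rewrite mulf_eq0 subr_eq0 => /orP[//|/eqP sc].
  (* Here [s = - c] would make [c * s + s * c] negative instead of 1. *)
  nra.
have qc : Num.sqrt 2 * c = 1.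
  have q0 : 0 <= Num.sqrt (2 : R) by rewrite sqrtr_ge0.
  have q2 : Num.sqrt (2 : R) ^+ 2 = 2 by rewrite sqr_sqrtr ?ler0n.
  have : (Num.sqrt 2 * c) ^+ 2 = 1 ^+ 2 by rewrite exprMn q2 expr1n; rewrite cs in e2; lra.
  by move/eqP; rewrite eqrXn2 ?mulr_ge0 ?(ltW c_gt0)// => /eqP.
by rewrite /s2 /sqrt2 cs; simpc; rewrite qc.
Qed.

End EighthRoots.

(** * Phase and modulus of the Tutte value *)

Section TutteValue.
Variable R : realType.
Local Notation C := R[i].
Local Notation I := ('i%C : C).
Local Notation s2 := (sqrt2 R).
Local Notation om := (expi (pi / 4 : R)).

Lemma expi_pi4_exp8 : om ^+ 8 = 1.
Proof. by rewrite (exprM _ 2 4) expi_pi4_sqr (exprM _ 2 2) sqr_i sqrrN expr1n. Qed.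

Lemma expi_pi4_mod8 k : om ^+ (k %% 8) = om ^+ k.
Proof. exact: expr_mod expi_pi4_exp8. Qed.

Lemma expi_pi4_neq0 : om != 0.
Proof. by apply/eqP => om0; have := expi_pi4_exp8; rewrite om0 expr0n => /eqP;
    rewrite eq_sym oner_eq0. Qed.

Lemma sqrt2_neq0 : s2 != 0.
Proof.
apply/eqP => s0; have := sqrt2_sqr R; rewrite s0 expr0n => /eqP.
by rewrite eq_sym pnatr_eq0.
Qed.

Lemma expi_pi4_conjc : om * conjc om = 1.
Proof.
rewrite /expi; simpc; rewrite -!expr2 cos2Dsin2.
by rewrite [sin _ * _]mulrC addNr.
Qed.

Variables (E : finType) (V : {vspace binvec E}).
Local Notation T := (tutte_value R V).
Local Notation S := (\sum_(v in V) iwt I v).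

(** This is [tutte_hyperbola] with [- i - 1 = sqrt 2 * om ^ 5] and [- i = om ^ 6]; the power
    [om ^ (3 * \dim V)] cancels [om ^ (5 * \dim V)], as [om ^ 8 = 1]. *)
Lemma tutte_gauss_sum :
  T * s2 ^+ \dim V = om ^+ (6 * #|E| + 3 * \dim V) * S.
Proof.
have I2 : I ^+ 2 = -1 by apply: sqr_i.
have omI : om ^+ 6 = - I by rewrite (exprM _ 2 3) expi_pi4_sqr exprS I2 mulrN1.
have := @tutte_hyperbola _ V C (- I) I; rewrite -/(tutte_value R V).
have -> : (- I - 1) * (I - 1) = 2 by ring: I2.
have -> : - I - 1 = s2 * om ^+ 5.
  rewrite exprS mulrA sqrt2_expi_pi4 (exprM _ 2 2) expi_pi4_sqr I2; ring.
move=> /(_ erefl) hyp.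
transitivity (om ^+ (3 * \dim V) * ((s2 * om ^+ 5) ^+ \dim V * T)).
  have omd : om ^+ (3 * \dim V) * (om ^+ 5) ^+ \dim V = 1.
    by rewrite -exprM -exprD -mulnDl (exprM _ 8) expi_pi4_exp8 expr1n.
  by rewrite exprMn -[LHS]mulr1 -omd; ring.
rewrite hyp addnC exprD -mulrA !mulr_sumr; apply: eq_bigr => v vV; congr (_ * _).
rewrite -omI /iwt -expi_pi4_sqr -!exprM -exprD.
have -> : (6 * #|E| + 2 * wt v = 6 * (#|E| - wt v) + 8 * wt v)%N.
  have : (wt v <= #|E|)%N by apply: max_card.
  lia.
by rewrite exprD (exprM _ 8) expi_pi4_exp8 expr1n mulr1.
Qed.

(** Multiplication by the complex conjugate equation removes the phases; the hypothesis makes [S]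
    nonzero, so [gauss_sum_modulus] leaves an equation between powers of 2. *)
Lemma tutte_modulus a k : T * s2 ^+ a = om ^+ k * s2 ^+ \dim V ->
  (a + \dim (V :&: Defs.orthov V) = \dim V)%N.
Proof.
set d := \dim V => eqT.
have s2d0 m : s2 ^+ m != 0 by rewrite expf_neq0 ?sqrt2_neq0.
have eqS : S * om ^+ (6 * #|E| + 3 * d) * s2 ^+ a = om ^+ k * s2 ^+ (2 * d).
  by rewrite [S * _]mulrC -tutte_gauss_sum mulrAC eqT mul2n -addnn exprD mulrA.
have S0 : S != 0.
  apply/eqP => S0; move/eqP: eqS.
  by rewrite S0 !mul0r eq_sym mulf_eq0 (negbTE (s2d0 _)) orbF expf_eq0 (negbTE expi_pi4_neq0)
      andbF.
have conjS : conjc S = \sum_(v in V) iwt (- I) v.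
  by rewrite rmorph_sum /=; apply: eq_bigr => v _; rewrite /iwt rmorphXn /=; congr (_ ^+ _);
      simpc.
have conjs2 : conjc s2 = s2 by rewrite /sqrt2 /= oppr0.
have S'0 : \sum_(v in V) iwt (- I) v != 0 by rewrite -conjS fmorph_eq0.
set om' := conjc om; set S' := \sum_(v in V) iwt (- I) v.
have eqS' : S' * om' ^+ (6 * #|E| + 3 * d) * s2 ^+ a = om' ^+ k * s2 ^+ (2 * d).
  have conjM (x y : C) : conjc (x * y) = conjc x * conjc y by apply: rmorphM.
  have conjX (x : C) n : conjc (x ^+ n) = conjc x ^+ n by apply: rmorphXn.
  by have := congr1 (@conjc R) eqS; rewrite !conjM !conjX conjS conjs2.
have : (S * S') * (om * om') ^+ (6 * #|E| + 3 * d) * (s2 ^+ 2) ^+ a =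
    (om * om') ^+ k * (s2 ^+ 2) ^+ (2 * d).
  by rewrite !expr2 !exprMn [RHS]mulrACA -eqS -eqS'; ring.
rewrite expi_pi4_conjc !expr1n mulr1 mul1r sqrt2_sqr gauss_sum_modulus //; last exact: sqr_i.
rewrite -exprD -!natrX => /eqP; rewrite eqr_nat eqn_exp2l // => /eqP; lia.
Qed.

End TutteValue.

(* m rows f remain to be eliminated; a, k and z are the contents of registers 5, 4 and 6. *)
Definition gauss_inv (E : finType) (V : {vspace binvec E}) (m : nat)
    (f : nat -> binvec E) (a k z : nat) : Prop :=
  forall R : realType,
    tutte_value R V * sqrt2 R ^+ (2 * m + a) =
    z%:R * expi (pi / 4) ^+ k * sqrt2 R ^+ \dim V * comb_sum m f (iwt 'i%C) 0.

(** * The invariant under the three kinds of elimination step *)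

Section GaussInvariant.
Variables (E : finType) (V : {vspace binvec E}).
Implicit Types (f g : nat -> binvec E) (m a k z : nat).

Lemma iwt_mod4 (R : rcfType) (v : binvec E) : iwt ('i%C : R[i]) v = 'i%C ^+ (wt v %% 4).
Proof. by rewrite /iwt expr_mod // (exprM _ 2 2) sqr_i sqrrN expr1n. Qed.

Lemma expi_pi4_wt (R : realType) (v : binvec E) :
  expi (pi / 4 : R) ^+ (2 * wt v) = iwt 'i%C v.
Proof. by rewrite exprM expi_pi4_sqr. Qed.

Lemma gauss_inv_init f (b : seq (binvec E)) : basis_of V b ->
  (forall x, (x < \dim V)%N -> f x = nth 0 b x) ->
  gauss_inv V (\dim V) f 0 ((6 * #|E| + 3 * \dim V) %% 8) 1.
Proof.
move=> /andP[/eqP bV b_free] fE R.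
have size_b : size b = \dim V by rewrite -bV; apply/esym/eqP.
rewrite addn0 mul2n -addnn exprD mulrA tutte_gauss_sum expi_pi4_mod8 mul1r.
rewrite (eq_comb_sum _ _ fE) -{5}size_b comb_sum_span // bV mulrAC.
by congr (_ * _); apply: eq_bigr => v _; rewrite add0r.
Qed.

(** The factor is 2, absorbed by the decrease of [2 * m], or 0, in which case the Tutte value is 0
    and the flag [z] records it. *)
Lemma gauss_inv_radical m f a k z : gauss_inv V m.+1 f a k z ->
  (forall x, (x <= m)%N -> ~~ odd (ndot (f x) (f m))) ->
  gauss_inv V m f a k (if (wt (f m) %% 4 == 2)%N then 0 else z).
Proof.
move=> inv orth R; have := inv R.
rewrite comb_sum_radical; [|exact: sqr_i|by move=> x xm; rewrite orth // ltnW].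
have := orth m (leqnn m); rewrite ndot_diag iwt_mod4 => wv.
have s0 := sqrt2_neq0 R.
case: eqP => [->|w2].
  rewrite sqr_i subrr mul0r mulr0 => /eqP; rewrite mulf_eq0 expf_eq0 (negbTE s0) andbF orbF.
  by move=> /eqP ->; rewrite !mul0r.
have -> : (wt (f m) %% 4 = 0)%N by lia.
rewrite expr0 -[1 + 1]/2 -(sqrt2_sqr R) => e.
apply: (mulIf (expf_neq0 2 s0)); rewrite -[LHS]mulrA -exprD.
rewrite (_ : (2 * m + a + 2 = 2 * m.+1 + a)%N); last by lia.
by rewrite e; ring.
Qed.

Lemma gauss_inv_odd m f g a k z : gauss_inv V m.+1 f a k z -> odd (wt (f m)) ->
  (forall x, (x < m)%N -> g x = eliminate (f m) (f m) (f x)) ->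
  gauss_inv V m g a.+1 ((k + 3 * (wt (f m) %% 4) + 6) %% 8) z.
Proof.
move=> inv wo gE R; have := inv R.
rewrite (comb_sum_odd (sqr_i R) wo gE).
have s0 := sqrt2_neq0 R; have I2 := sqr_i R.
(* The linear exponent takes the values 9 and 15 at weights 1 and 3 modulo 4, matching
   [1 + i = sqrt 2 * om] and [1 - i = sqrt 2 * om ^ 7]. *)
have -> : 1 + iwt 'i%C (f m) = sqrt2 R * expi (pi / 4) ^+ (3 * (wt (f m) %% 4) + 6).
  rewrite iwt_mod4; have : (wt (f m) %% 4 = 1 \/ wt (f m) %% 4 = 3)%N by lia.
  case=> ->; first by rewrite (exprS _ 8) expi_pi4_exp8 mulr1 sqrt2_expi_pi4.
  rewrite -expi_pi4_mod8 (exprS _ 6) mulrA sqrt2_expi_pi4 (exprM _ 2 3) expi_pi4_sqr.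
  rewrite exprS I2; ring: I2.
move=> e; apply: (mulIf s0); rewrite -[LHS]mulrA -exprSr expi_pi4_mod8 -addnA exprD.
rewrite (_ : ((2 * m + a.+1).+1 = 2 * m.+1 + a)%N); last by lia.
by rewrite e; ring.
Qed.

(** After division by 2 the factor is 1 or [iwt (f j) = om ^ (2 * wt (f j))], according to
    [wt (f m) %% 4] being 0 or 2. Only one row is removed; row [j], now zero, is met later as a
    radical row of weight 0. *)
Lemma gauss_inv_hyperbolic m f g j a k z : gauss_inv V m.+1 f a k z -> (j < m)%N ->
  ~~ odd (wt (f m)) -> odd (ndot (f m) (f j)) ->
  (forall x, (x < m)%N -> g x = eliminate (f m) (f j) (f x)) ->
  gauss_inv V m g a.+2 ((k + (wt (f m) %% 4) * wt (f j)) %% 8) z.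
Proof.
move=> inv jm wv vu gE R; have := inv R.
have := comb_sum_hyperbolic (sqr_i R) jm wv vu gE.
have -> : (2 * m.+1 + a = 2 * m + a.+2)%N by lia.
set G := comb_sum m.+1 _ _ _; set G' := comb_sum m _ _ _ => eG ->.
have {eG} -> : G = expi (pi / 4) ^+ (wt (f m) %% 4 * wt (f j)) * G'.
  apply: (@mulfI _ 2); first by rewrite pnatr_eq0.
  rewrite eG iwt_mod4.
  have : (wt (f m) %% 4 = 0 \/ wt (f m) %% 4 = 2)%N by lia.
  case=> ->; first by rewrite mul0n !expr0; ring.
  by rewrite expi_pi4_wt sqr_i; ring.
by rewrite expi_pi4_mod8 exprD; ring.
Qed.

Lemma gauss_inv_end f a k z : (z <= 1)%N -> gauss_inv V 0 f a k z ->
  forall R : realType, z = (tutte_value R V != 0) /\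
  (tutte_value R V <> 0 ->
   (\dim V - a)%N = \dim (V :&: Defs.orthov V) /\
   tutte_value R V = expi (pi * k%:R / 4) * sqrt2 R ^+ (\dim V - a)).
Proof.
move=> z1 inv R; have /= := inv R; rewrite /iwt wt0 expr0 mulr1 add0n.
have s0 := sqrt2_neq0 R; have s_exp n := expf_neq0 n s0.
case: z z1 {inv} => [|[|//]] _.
  rewrite !mul0r => /eqP; rewrite mulf_eq0 (negbTE (s_exp _)) orbF => /eqP ->.
  by rewrite eqxx.
rewrite mul1r => e; have leq := tutte_modulus e.
have -> : tutte_value R V = expi (pi * k%:R / 4) * sqrt2 R ^+ (\dim V - a).
  apply: (mulIf (s_exp a)); rewrite e -[RHS]mulrA -exprD subnK ?expi_natmul //; lia.
split; last by split=> //; lia.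
by rewrite expi_natmul mulf_neq0 // expf_neq0 // expi_pi4_neq0.
Qed.

End GaussInvariant.

(** * The program *)

Local Open Scope nat_scope.

(** Total correctness from a fixed initial state, with time bound [B]. *)
Definition run (w : nat) (c : cmd) (s : state) (Q : state -> Prop) (B : nat) : Prop :=
  exists s' t, [/\ exec w c s s' t, t <= B & Q s'].

(** Counting down lets the counter serve as the test; the body sees the indices from the bound minus
    1 to 0. *)
Definition loop (i : nat) (hi : expr) (body : cmd) : cmd :=
  Seq (Assign i hi)
      (While (Reg i) (Seq (Assign i (Op OSub (Reg i) (Const 1))) body)).

Definition same_regs (l : seq nat) (s s' : state) : Prop :=
  forall r, r \notin l -> reg s' r = reg s r.

(** * Rules for correctness and time of commands *)

Section Runs.
Variable w : nat.
Implicit Types (c : cmd) (s : state) (P Q : state -> Prop) (B : nat).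

Lemma run_conseq c s P Q B B' :
  run w c s P B -> (forall s', P s' -> Q s') -> B <= B' -> run w c s Q B'.
Proof.
move=> [s' [t [ex tB Ps']]] PQ BB'; exists s', t; split=> //; last exact: PQ.
exact: leq_trans BB'.
Qed.

Lemma run_leq c s Q B B' : run w c s Q B -> B <= B' -> run w c s Q B'.
Proof. by move=> /run_conseq rcQ leB; apply: rcQ. Qed.

Lemma run_skip s Q B : Q s -> 0 < B -> run w Skip s Q B.
Proof. by exists s, 1; split=> //; constructor. Qed.

Lemma run_assign x e s Q B v :
  eval w s e = v -> Q (set_reg s x v) -> ecost e < B -> run w (Assign x e) s Q B.
Proof. by move=> <- Qs cB; do 2!eexists; split; [apply: exec_assign| |]. Qed.

Lemma run_store a e s Q B l v :
  eval w s a = l -> eval w s e = v -> Q (set_mem s l v) ->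
  ecost a + ecost e < B -> run w (Store a e) s Q B.
Proof. by move=> <- <- Qs cB; do 2!eexists; split; [apply: exec_store| |]. Qed.

Lemma run_seq P c1 c2 s Q B1 B2 B :
  run w c1 s P B1 -> (forall s1, P s1 -> run w c2 s1 Q B2) -> B1 + B2 <= B ->
  run w (Seq c1 c2) s Q B.
Proof.
move=> [s1 [t1 [ex1 le1 /[swap]/[apply] [[s2 [t2 [ex2 le2 Qs2]]]]]]] leB.
exists s2, (t1 + t2); split=> //; first exact: exec_seq ex1 ex2.
by apply: leq_trans leB; apply: leq_add.
Qed.

Lemma run_if e c1 c2 s Q B v : eval w s e = v ->
  run w (if v != 0 then c1 else c2) s Q B ->
  run w (If e c1 c2) s Q (ecost e + B).+1.
Proof.
move=> <- [s' [t [ex tB Qs']]]; exists s', (ecost e + t).+1; split=> //.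
  exact: exec_if.
by rewrite ltnS leq_add2l.
Qed.

(** [I k] describes the state once all indices from [k] on are processed. The 6 units per round pay
    for the test and the decrement. *)
Lemma run_loop (I : nat -> state -> Prop) i hi body B Q s N :
  1 < 2 ^ w -> N <= 2 ^ w -> eval w s hi = N -> I N (set_reg s i N) ->
  (forall k s1, k < N -> I k.+1 s1 -> reg s1 i = k.+1 ->
     run w body (set_reg s1 i k) (fun s2 => reg s2 i = k /\ I k s2) B) ->
  (forall s1, reg s1 i = 0 -> I 0 s1 -> Q s1) ->
  run w (loop i hi body) s Q (ecost hi + N * (B + 6) + 3).
Proof.
move=> w1 Nw evhi I0 step fin.
apply: (@run_seq (fun s1 => reg s1 i = N /\ I N s1) _ _ _ _ (ecost hi).+1 (N * (B + 6) + 2));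
    last by lia.
  by apply: (run_assign evhi) => //=; rewrite /upd eqxx.
suff H k : k <= N -> forall s1, reg s1 i = k /\ I k s1 ->
    run w (While (Reg i) (Seq (Assign i (Op OSub (Reg i) (Const 1))) body)) s1 Q
      (k * (B + 6) + 2) by apply: H.
elim: k => [|k IH] kN s1 [s1i Is1].
  exists s1, 2; split=> //; last exact: fin.
  by apply: (@exec_while_end w (Reg i)).
have [s2 [t2 [ex2 le2 [s2i Is2]]]] := step k s1 kN Is1 s1i.
have [s3 [t3 [ex3 le3 Qs3]]] := IH (ltnW kN) s2 (conj s2i Is2).
exists s3, (1 + (4 + t2) + t3).+1; split=> //; last by lia.
apply: (@exec_while w (Reg i) _ s1 s2 s3) ex3; first by rewrite /= s1i.
apply: (@exec_seq _ _ _ s1 (set_reg s1 i k) s2 4 t2) ex2.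
have := exec_assign w i (Op OSub (Reg i) (Const 1)) s1.
by rewrite /= s1i (modn_small w1) subn1 /= modn_small // (leq_trans kN).
Qed.

End Runs.

Definition addr (x : nat) : expr := Op OAdd (Op OMul (Reg x) (Reg 1)) (Reg 8).

Definition dotc (x y : nat) : cmd :=
  Seq (Assign 9 (Const 0))
      (loop 8 (Reg 1)
         (Assign 9 (Op OAdd (Reg 9) (Op OMul (Defs.Mem (addr x)) (Defs.Mem (addr y)))))).

(* Row x becomes b * row x + row y: an addition for b = 1, a copy for b = 0. *)
Definition rowop (b : bool) (x y : nat) : cmd :=
  loop 8 (Reg 1)
    (Store (addr x)
       (Op OMod (Op OAdd (Op OMul (Const b) (Defs.Mem (addr x))) (Defs.Mem (addr y))) (Const 2))).

(** * Inner products and row operations in memory, without overflow *)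

Section Rows.
Variables (E : finType) (w d : nat).
Local Notation n := #|E|.
Hypothesis word_size : 100 * (d.+1 * n.+1) <= 2 ^ w.
Implicit Types (s : state).

Definition row s (x : nat) : binvec E := [ffun e => (Defs.mem s (x * n + enum_rank e))%:R%R].

Definition bits s : Prop := forall a, Defs.mem s a <= 1.

Lemma small_const k : k < 100 -> k %% 2 ^ w = k.
Proof. by move=> k100; rewrite modn_small //; apply: leq_trans word_size; lia. Qed.

Lemma word_gt1 : 1 < 2 ^ w.
Proof. by apply: leq_trans word_size; nia. Qed.

Lemma small_lin k : k < 50 * (d + n) -> k %% 2 ^ w = k.
Proof. by move=> k100; rewrite modn_small //; apply: leq_trans word_size; nia. Qed.

Lemma eval_addr s x r k : reg s 1 = n -> reg s x = r -> reg s 8 = k ->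
  r <= d -> k < n -> eval w s (addr x) = r * n + k.
Proof.
move=> s1 sx s8 rd kn; rewrite /= s1 sx s8.
have le : r * n + k < 2 ^ w.
  apply: leq_trans word_size; have : r * n <= d * n by rewrite leq_mul2r rd orbT.
  nia.
by rewrite modnDml modn_small.
Qed.

Lemma row_neq0 s x e : bits s -> (row s x e != 0%R) = (Defs.mem s (x * n + enum_rank e)) :> nat.
Proof.
by move=> bs; rewrite ffunE; have := bs (x * n + enum_rank e); case: Defs.mem => [|[|]].
Qed.

Lemma ndot_rows s x y : bits s ->
  \sum_(0 <= e < n) Defs.mem s (x * n + e) * Defs.mem s (y * n + e) = ndot (row s x) (row s y).
Proof.
move=> bs; rewrite big_mkord (reindex (@enum_rank E)) /=; last first.
  by apply: onW_bij; apply: enum_rank_bij.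
rewrite /ndot -[RHS]sum1_card [RHS]big_mkcond /=; apply: eq_bigr => e _.
rewrite -!row_neq0 // !inE.
by case: (row s x e != 0%R); case: (row s y e != 0%R).
Qed.

Hypothesis n_gt0 : 0 < n.

Lemma run_dotc s x y : x \notin [:: 8; 9] -> y \notin [:: 8; 9] -> bits s ->
  reg s 1 = n -> reg s x <= d -> reg s y <= d ->
  run w (dotc x y) s (fun s' =>
    [/\ reg s' 9 = ndot (row s (reg s x)) (row s (reg s y)), Defs.mem s' = Defs.mem s
      & same_regs [:: 8; 9] s s']) (28 * n).
Proof.
move=> x89 y89 bs s1 sx sy.
(* The columns are visited in descending order, so the partial sums start at [k]. *)
pose psum k := \sum_(k <= e < n) Defs.mem s (reg s x * n + e) * Defs.mem s (reg s y * n + e).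
have psumS k : k < n ->
    psum k = Defs.mem s (reg s x * n + k) * Defs.mem s (reg s y * n + k) + psum k.+1.
  by move=> kn; rewrite /psum big_ltn.
have psum_le k : psum k <= n.
  rewrite (@leq_trans (\sum_(k <= e < n) 1)) //; last by rewrite sum_nat_const_nat muln1 leq_subr.
  by apply: leq_sum => e _; rewrite (@leq_mul _ _ 1 1) ?bs.
apply: (@run_seq _ (fun s' => [/\ reg s' 9 = 0, Defs.mem s' = Defs.mem s & same_regs [:: 8;
    9] s s'])
          _ _ _ _ 2 (1 + n * (16 + 6) + 3)); last by lia.
  apply: (run_assign (v := 0)) => //=; first by rewrite small_const.
  split=> // r; rewrite /= /upd !inE negb_or => /andP[_ /negbTE->] //.
move=> s0 [s09 s0m s0r].
apply: (run_loop (I := fun k s' => [/\ reg s' 9 = psum k, Defs.mem s' = Defs.mem s & same_regs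
    [:: 8; 9] s s'])).
- exact: word_gt1.
- by apply: leq_trans word_size; nia.
- by rewrite /= s0r.
- split=> //=; first by rewrite /upd /= s09 /psum big_geq.
  by move=> r r89; rewrite -s0r //= /upd; move: r89; rewrite !inE negb_or => /andP[/negbTE->].
- move=> k s2 kn [s29 s2m s2r] s28.
  set s3 := set_reg s2 8 k.
  have s3r : same_regs [:: 8; 9] s s3.
    by move=> r r89; rewrite -s2r //= /upd; move: r89; rewrite !inE negb_or => /andP[/negbTE->].
  have adr z : z \notin [:: 8; 9] -> reg s z <= d ->
      eval w s3 (addr z) = reg s z * n + k.
    by move=> z89 sz; apply: eval_addr => //; rewrite s3r.
  apply: (run_assign (v := psum k)) => //.
    have -> : forall a b, eval w s3 (Op OAdd (Reg 9) (Op OMul (Defs.Mem a) (Defs.Mem b))) =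
       (reg s3 9 + (Defs.mem s3 (eval w s3 a) * Defs.mem s3 (eval w s3 b)) %% 2 ^ w) %% 2 ^ w
           by [].
    rewrite !adr // modnDmr {1}/s3 /= /upd /= s29 s2m addnC -psumS // small_lin //.
    by have := psum_le k; lia.
  split; [by [] | split=> //].
  by move=> r r89; rewrite -s3r //= /upd; move: r89; rewrite !inE negb_or => /andP[_ /negbTE->].
- move=> s2 _ [s29 s2m s2r]; split=> //.
  by rewrite s29 /psum ndot_rows.
Qed.

Lemma run_rowop b s x y : x != 8 -> y != 8 -> bits s ->
  reg s 1 = n -> reg s x <= d -> reg s y <= d -> reg s x != reg s y ->
  run w (rowop b x y) s (fun s' =>
    [/\ forall z, row s' z = if z == reg s x
          then ((if b then row s (reg s x) else 0) + row s (reg s y))%R else row s z,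
        bits s' & same_regs [:: 8] s s']) (33 * n).
Proof.
move=> x8 y8 bs s1 sx sy xy.
pose new a := (b * Defs.mem s a + Defs.mem s (reg s y * n + (a - reg s x * n))) %% 2.
pose newmem k a :=
  if reg s x * n + k <= a < reg s x * n + n then new a else Defs.mem s a.
have same8 s' v : same_regs [:: 8] s s' -> same_regs [:: 8] s (set_reg s' 8 v).
  by move=> s'r z z8; rewrite -s'r //= /upd; move: z8; rewrite inE => /negbTE->.
apply: (@run_conseq _ _ _ _ _ (1 + n * (23 + 6) + 3)); last 1 first.
- by lia.
- apply: (run_loop (I := fun k s' => Defs.mem s' =1 newmem k /\ same_regs [:: 8] s s') (Q :=
    fun s' => Defs.mem s' =1 newmem 0 /\ same_regs [:: 8] s s')).
  + exact: word_gt1.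
  + by apply: leq_trans word_size; nia.
  + by [].
  + split; last by apply: same8.
    by move=> a; rewrite /newmem; case: andP => // -[]; lia.
  + move=> k s2 kn [s2m s2r] s28; set s3 := set_reg s2 8 k.
    have s3r : same_regs [:: 8] s s3 by apply: same8.
    have adr z : z != 8 -> reg s z <= d -> eval w s3 (addr z) = reg s z * n + k.
      by move=> z8 sz; apply: eval_addr => //; rewrite s3r // inE.
    (* Column [k] is still unmodified in every row, as only later columns of row [reg s x] have been
       rewritten. *)
    have old z : z <= d -> Defs.mem s2 (z * n + k) = Defs.mem s (z * n + k).
      move=> zd; rewrite s2m /newmem; case: andP => // -[h1 h2].
      have : z = reg s x by nia.
      lia.
    apply: (run_store (l := reg s x * n + k) (v := new (reg s x * n + k))) => //.
    * exact: adr.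
    * have -> : forall p q, eval w s3 (Op OMod (Op OAdd (Op OMul (Const b) (Defs.Mem p))
        (Defs.Mem q)) (Const 2)) =
        ((((b %% 2 ^ w) * Defs.mem s3 (eval w s3 p)) %% 2 ^ w + Defs.mem s3 (eval w s3 q)) %% 2
            ^ w) %% (2 %% 2 ^ w) %% 2 ^ w by [].
      rewrite !adr // !old //.
      rewrite /new addKn.
      have := bs (reg s x * n + k); have := bs (reg s y * n + k).
      have -> : b %% 2 ^ w = b by apply: small_const; case: (b).
      rewrite modnDml (small_const (k := 2)) // => m1 m2.
      rewrite (small_const (k := b * _ + _)); last by case: (b); lia.
      by rewrite small_const // (leq_trans (ltn_pmod _ _)).
    * split; first by rewrite /= /upd; case: eqP.
      split=> // a; rewrite /= /upd s2m /newmem.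
      case: eqP => [->|ak]; first by rewrite leqnn ltn_add2l kn.
      by rewrite addnS ltn_neqAle eq_sym; move/eqP: ak => ->.
  + by [].
- move=> s' [s'm s'r]; split=> //.
  + move=> z; apply/ffunP => e; rewrite ffunE s'm /newmem addn0.
    have en : enum_rank e < n by apply: ltn_ord.
    have -> : (reg s x * n <= z * n + enum_rank e < reg s x * n + n) = (z == reg s x).
      apply/andP/eqP => [[h1 h2]|->]; last by rewrite leq_addr ltn_add2l.
      apply/eqP; rewrite eqn_leq -ltnS -(ltn_pmul2r n_gt0) mulSn andbC.
      rewrite -ltnS -(ltn_pmul2r n_gt0) mulSn; lia.
    case: eqP => [->|_]; last by rewrite ffunE.
    rewrite /new addKn ffunE (fun_if (fun f : binvec E => f e)) !ffunE.
    set m1 := Defs.mem s _; set m2 := Defs.mem s _.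
    have -> : ((b * m1 + m2) %% 2)%:R%R = (b * m1 + m2)%:R%R :> 'F_2.
      by apply: F2_eq; rewrite !F2_natr_eq0 modn2 oddb.
    by rewrite natrD; case: (b); rewrite ?mul1n ?mul0n.
  + move=> a; rewrite s'm /newmem; case: ifP => _ //.
    by rewrite -ltnS ltn_mod.
Qed.

End Rows.

Definition odd9 : expr := Op OMod (Reg 9) (Const 2).

(* Register 2 holds the index m of the current row v, and register 0 holds d,
   the index of a spare row. Register 3 becomes m if v has odd weight, otherwise
   the index k < m of some row not orthogonal to v, or d if there is none;
   register 10 becomes the weight of v. *)
Definition find_pivot : cmd :=
  Seq (Assign 3 (Reg 0))
  (Seq (loop 7 (Reg 2)
          (Seq (dotc 2 7) (If odd9 (Assign 3 (Reg 7)) Skip)))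
  (Seq (dotc 2 2)
  (Seq (Assign 10 (Reg 9))
       (If odd9 (Assign 3 (Reg 2)) Skip)))).

(* The pivot is copied to the spare row because its own row is eliminated too. *)
Definition eliminate_rows : cmd :=
  Seq (rowop false 0 3)
  (Seq (dotc 0 0)
  (Seq (Assign 11 (Reg 9))
       (loop 7 (Reg 2)
          (Seq (dotc 7 2)
          (Seq (If odd9 (rowop true 7 0) Skip)
          (Seq (dotc 7 0)
               (If odd9 (rowop true 7 2) Skip))))))).

(** * Pivot search and elimination of the rows *)

Section Steps.
Variables (E : finType) (w d : nat).
Local Notation n := #|E|.
Hypothesis word_size : 100 * (d.+1 * n.+1) <= 2 ^ w.
Hypothesis n_gt0 : 0 < n.
Implicit Types (s : state).

Lemma eval_odd9 s k : reg s 9 = k -> eval w s odd9 = odd k.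
Proof.
move=> s9; rewrite /= s9 (@small_const _ _ _ word_size 2) // modn2.
by rewrite (small_const word_size) //; case: odd.
Qed.

Lemma same_regsW l l' s s' : {subset l <= l'} -> same_regs l s s' -> same_regs l' s s'.
Proof. by move=> ll' ss' r rl'; apply: ss'; apply: contra rl' => /ll'. Qed.

Lemma same_regs_trans l s1 s2 s3 :
  same_regs l s1 s2 -> same_regs l s2 s3 -> same_regs l s1 s3.
Proof. by move=> s12 s23 r rl; rewrite s23 // s12. Qed.

Lemma same_regs_set l s x v : x \in l -> same_regs l s (set_reg s x v).
Proof.
by move=> xl r rl; rewrite /= /upd; case: eqP => // rx; rewrite rx xl in rl.
Qed.

Lemma eq_row s s' : Defs.mem s' = Defs.mem s -> row E s' =1 row E s.
Proof. by move=> sm x; apply/ffunP => e; rewrite !ffunE sm. Qed.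

(** The index [j] encodes the case: odd weight, hyperbolic partner, or radical vector, the last
    marked by [d], which is not the index of a basis row. *)
Definition is_pivot (f : nat -> binvec E) (m j : nat) : Prop :=
  [\/ odd (wt (f m)) /\ j = m,
      [/\ ~~ odd (wt (f m)), j < m & odd (ndot (f m) (f j))]
    | j = d /\ forall x, x <= m -> ~~ odd (ndot (f x) (f m))].

Lemma run_find_pivot s m : bits s -> reg s 0 = d -> reg s 1 = n -> reg s 2 = m -> m < d ->
  run w find_pivot s (fun s' =>
    [/\ Defs.mem s' = Defs.mem s, same_regs [:: 3; 7; 8; 9; 10] s s',
        reg s' 10 = wt (row E s m) & is_pivot (row E s) m (reg s' 3)]) (100 * (d * n)).
Proof.
move=> bs s0 s1 s2 md; pose L := [:: 3; 7; 8; 9; 10]; pose f := row E s.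
have subL : {subset [:: 8; 9] <= L} by move=> r; rewrite !inE => /orP[] /eqP->.
have d1 : 0 < d by apply: leq_ltn_trans md.
(* Rows from [m0] on have been tested; a later find may overwrite an earlier one. *)
pose J m0 s' := [/\ Defs.mem s' = Defs.mem s, same_regs L s s' &
  (reg s' 3 < m /\ odd (ndot (f m) (f (reg s' 3)))) \/
  (reg s' 3 = d /\ forall x, m0 <= x < m -> ~~ odd (ndot (f m) (f x)))].
apply: (@run_seq _ (J m) _ _ _ _ 2 (80 * (d * n))); last by nia.
  apply: (run_assign (v := d)) => //; split=> //; first exact: same_regs_set.
  by right; split=> // x /andP[/leq_ltn_trans h /h]; rewrite ltnn.
move=> s3 Js3.
apply: (@run_seq _ (J 0) _ _ _ _ (1 + m * (34 * n + 6) + 3) (38 * n)); last first.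
- have : m * (34 * n + 6) <= d * (40 * n) by apply: leq_mul; [exact: ltnW|lia].
  nia.
- move=> s4 [s4m s4r pivot].
  pose P s' := [/\ Defs.mem s' = Defs.mem s, same_regs L s s', reg s' 3 = reg s4 3 & reg s' 9 =
      wt (f m)].
  apply: (@run_seq _ P _ _ _ _ (28 * n) 10); last by lia.
    apply: run_conseq (@run_dotc _ _ _ word_size n_gt0 _ 2 2 _ _ _ _ _ _) _ (leqnn _) => //.
    + by move=> a; rewrite s4m.
    + by rewrite s4r.
    + by rewrite s4r // s2 ltnW.
    + by rewrite s4r // s2 ltnW.
    move=> s5 [s59 s5m s5r]; split; first by rewrite s5m.
    * exact: same_regs_trans s4r (same_regsW subL s5r).
    * by rewrite s5r.
    * by rewrite s59 !(eq_row s4m) s4r // s2 ndot_diag.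
  move=> s5 [s5m s5r s53 s59].
  pose P' s' := P s' /\ reg s' 10 = wt (f m).
  apply: (@run_seq _ P' _ _ _ _ 2 7) => //.
    apply: (run_assign (v := wt (f m))) => //; split=> //; split=> //.
    exact: same_regs_trans s5r (same_regs_set _ _ _).
  move=> s6 [[s6m s6r s63 s69] s6w].
  apply: (run_if (B := 3) (eval_odd9 s69)).
  case wo: (odd (wt (f m))) => /=.
    apply: (run_assign (v := m)) => //; first by rewrite /= s6r.
    split=> //; last by constructor 1.
    exact: same_regs_trans s6r (same_regs_set _ _ _).
  apply: run_skip => //; split=> //; rewrite s63.
  case: pivot => [[jm jo]|[jd none]]; first by constructor 2; rewrite -/f wo.
  constructor 3; split=> // x; rewrite leq_eqVlt ndotC => /orP[/eqP->|xm].
    by rewrite ndot_diag wo.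
  exact: none.
apply: (run_loop (I := fun k s' => J k s')) => //.
- exact: word_gt1 word_size.
- by apply: leq_trans word_size; nia.
- by have [_ s3r _] := Js3; rewrite /= s3r.
- have [s3m s3r pivot] := Js3; split=> //.
  exact: same_regs_trans s3r (same_regs_set _ _ _).
- move=> k s4 km [s4m s4r pivot] s47; set s5 := set_reg s4 7 k.
  have s5r : same_regs L s s5 by apply: same_regs_trans s4r (same_regs_set _ _ _).
  pose P s' := [/\ Defs.mem s' = Defs.mem s, same_regs L s s', reg s' 3 = reg s4 3, reg s' 7 =
      k & reg s' 9 = ndot (f m) (f k)].
  apply: (@run_seq _ P _ _ _ _ (28 * n) 6); last by lia.
    apply: run_conseq (@run_dotc _ _ _ word_size n_gt0 _ 2 7 _ _ _ _ _ _) _ (leqnn _) => //.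
    + by move=> a; rewrite s4m.
    + by rewrite s5r.
    + by rewrite s5r // s2 ltnW.
    + by rewrite /s5 /= ltnW // (ltn_trans km).
    move=> s6 [s69 s6m s6r]; split; first by rewrite s6m.
    * exact: same_regs_trans s5r (same_regsW subL s6r).
    * by rewrite s6r.
    * by rewrite s6r.
    * by rewrite s69 !(@eq_row s s5) // s5r // s2.
  move=> s6 [s6m s6r s63 s67 s69].
  apply: (@run_leq _ _ _ _ (3 + 2).+1); last by [].
  apply: (run_if (eval_odd9 s69)).
    case wo: (odd (ndot (f m) (f k))) => /=.
      apply: (run_assign (v := k)) => //; split=> //; split=> //.
        exact: same_regs_trans s6r (same_regs_set _ _ _).
      by left.
    apply: run_skip => //; split=> //; split=> //; rewrite s63.
    case: pivot => [|[jd none]]; [by left|right; split=> // x].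
    by rewrite leq_eqVlt => /andP[/orP[/eqP<-|kx] xm]; rewrite ?wo // none // kx.
Qed.

Lemma run_eliminate_rows s m j : bits s -> reg s 0 = d -> reg s 1 = n -> reg s 2 = m ->
  reg s 3 = j -> m < d -> j < d ->
  run w eliminate_rows s (fun s' =>
    [/\ bits s', same_regs [:: 7; 8; 9; 11] s s', reg s' 11 = wt (row E s j)
      & forall x, x < m ->
          row E s' x = eliminate (row E s m) (row E s j) (row E s x)]) (300 * (d * n)).
Proof.
move=> bs s0 s1 s2 s3 md jd; pose L := [:: 7; 8; 9; 11]; pose f := row E s.
have subL : {subset [:: 8; 9] <= L} by move=> r; rewrite !inE => /orP[] /eqP->.
have subL8 : {subset [:: 8] <= L} by move=> r; rewrite !inE => /eqP->.
have d1 : 0 < d by apply: leq_ltn_trans md.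
pose J k s' := [/\ bits s', same_regs L s s', row E s' d = f j, row E s' m = f m &
  forall x, x < m -> row E s' x = if k <= x then eliminate (f m) (f j) (f x) else f x].
apply: (@run_seq _ (J m) _ _ _ _ (33 * n) (240 * (d * n))); last by nia.
  apply: run_conseq (@run_rowop _ _ _ word_size n_gt0 false _ 0 3 _ _ _ _ _ _ _) _ (leqnn _) =>
      //.
  - by rewrite s0.
  - by rewrite s3 ltnW.
  - by rewrite s0 s3 neq_ltn jd orbT.
  move=> s4 [rows bs4 s4r]; split=> //.
  - exact: same_regsW s4r.
  - by rewrite rows s0 s3 eqxx add0r.
  - by rewrite rows s0 ltn_eqF.
  - by move=> x xm; rewrite rows s0 (ltn_eqF (ltn_trans xm md)) leqNgt xm.
move=> s4 [bs4 s4r rd rm rx].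
pose P s' := J m s' /\ reg s' 9 = wt (f j).
apply: (@run_seq _ P _ _ _ _ (28 * n) (200 * (d * n))); last by nia.
  apply: run_conseq (@run_dotc _ _ _ word_size n_gt0 _ 0 0 _ _ _ _ _ _) _ (leqnn _) => //.
  - by rewrite s4r.
  - by rewrite s4r // s0.
  - by rewrite s4r // s0.
  move=> s5 [s59 s5m s5r]; split; last by rewrite s59 s4r // s0 rd ndot_diag.
  split; rewrite ?(eq_row s5m) //; first by move=> a; rewrite s5m.
    exact: same_regs_trans s4r (same_regsW subL s5r).
  by move=> x; rewrite (eq_row s5m); apply: rx.
move=> s5 [[bs5 s5r s5d s5m s5x] s59].
pose J' k s' := J k s' /\ reg s' 11 = wt (f j).
apply: (@run_seq _ (J' m) _ _ _ _ 2 (1 + m * (150 * n + 6) + 3)); last first.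
- have : m * (150 * n + 6) <= d * (156 * n) by apply: leq_mul; [exact: ltnW|lia].
  nia.
- move=> s6 [[bs6 s6r s6d s6m s6x] s6w].
  apply: (run_loop (I := J')) => //.
  + exact: word_gt1 word_size.
  + by apply: leq_trans word_size; nia.
  + by rewrite /= s6r.
  + split=> //; split=> //.
    exact: same_regs_trans s6r (same_regs_set _ _ _).
  + move=> k s7 km [[bs7 s7r s7d s7m s7x] s7w] s77; set s8 := set_reg s7 7 k.
    pose g y := if odd (ndot y (f m)) then (y + f j)%R else y.
    (* The state within round [k]: row [k] currently holds [y], later rows are finished, and the
       pivot copy and row [m] are intact. *)
    pose P0 y s' := [/\ bits s' /\ reg s' 11 = wt (f j), same_regs L s s', reg s' 7 = k, row E
        s' d = f j /\ row E s' m = f m &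
      forall x, x < m -> row E s' x = if k == x then y else if k < x then eliminate (f m) (f j)
          (f x) else f x].
    have kd : k < d by apply: ltn_trans md.
    have dot y s9 z v : P0 y s9 -> z \notin [:: 7; 8; 9] -> reg s z <= d ->
        z \notin L -> row E s9 (reg s z) = v ->
        run w (dotc 7 z) s9 (fun s' => P0 y s' /\ reg s' 9 = ndot y v) (28 * n).
      move=> [[b9 w9] r9 k9 [d9 m9] x9] z79 zd zL zv.
      apply: run_conseq (@run_dotc _ _ _ word_size n_gt0 _ 7 z _ _ _ _ _ _) _ (leqnn _) => //.
      - by move: z79; rewrite !inE !negb_or => /and3P[_ -> ->].
      - by rewrite r9.
      - by rewrite k9 ltnW.
      - by rewrite r9.
      move=> s10 [r10 m10 sr10]; split; last first.
        by rewrite r10 k9 x9 // eqxx r9 // zv.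
      split; rewrite ?(eq_row m10) ?sr10 //.
      - by split=> // a; rewrite m10.
      - exact: same_regs_trans r9 (same_regsW subL sr10).
      - by move=> x; rewrite (eq_row m10); apply: x9.
    have add y s9 z v : P0 y s9 -> z != 8 -> reg s z <= d -> z \notin L ->
        reg s z != k -> row E s9 (reg s z) = v ->
        run w (rowop true 7 z) s9 (P0 (y + v)%R) (33 * n).
      move=> [[b9 w9] r9 k9 [d9 m9] x9] z8 zd zL zk zv.
      apply: run_conseq (@run_rowop _ _ _ word_size n_gt0 true _ 7 z _ _ _ _ _ _ _) _ (leqnn _)
          => //.
      - by rewrite r9.
      - by rewrite k9 ltnW.
      - by rewrite r9.
      - by rewrite k9 r9 // eq_sym.
      move=> s10 [rows b10 sr10]; split; rewrite ?sr10 //.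
      - exact: same_regs_trans r9 (same_regsW subL8 sr10).
      - by rewrite !rows k9 !gtn_eqF.
      - move=> x xm; rewrite rows k9 [x == k]eq_sym; case: eqP => [_|kx].
          by rewrite x9 // eqxx r9 // zv.
        by rewrite x9 //; case: eqP.
    apply: (@run_seq _ (fun s' => P0 (f k) s' /\ reg s' 9 = ndot (f k) (f m)) _ _ _ _ (28 * n)
        (110 * n)); last by lia.
      apply: dot => //; rewrite ?s2 ?(ltnW md) //.
      split=> //.
      * exact: same_regs_trans s7r (same_regs_set _ _ _).
      * move=> x xm; rewrite -[row E s8 x]/(row E s7 x) s7x //.
        by case: ltngtP => // ->.
    move=> s9 [P9 s99].
    apply: (@run_seq _ (P0 (g (f k))) _ _ _ _ (3 + 33 * n).+1 (70 * n)); last by lia.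
      apply: (run_if (eval_odd9 s99)); rewrite /g; case: (odd (ndot (f k) (f m))) => /=.
        apply: add => //; rewrite ?s0 ?gtn_eqF //.
        by case: P9 => _ _ _ [].
      by apply: run_skip; rewrite ?muln_gt0.
    move=> s10 P10.
    apply: (@run_seq _ (fun s' => P0 (g (f k)) s' /\ reg s' 9 = ndot (g (f k)) (f j)) _ _ _ _
        (28 * n) (40 * n)); last by lia.
      apply: dot => //; rewrite ?s0 //.
      by case: P10 => _ _ _ [].
    move=> s11 [P11 s119].
    apply: (@run_conseq _ _ _ (P0 (eliminate (f m) (f j) (f k))) _ (3 + 33 * n).+1); last by lia.
      apply: (run_if (eval_odd9 s119)); rewrite /eliminate -/(g (f k));
          case: (odd (ndot (g (f k)) (f j))) => /=.
        apply: add => //; rewrite ?s2 ?(ltnW md) ?gtn_eqF //.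
        by case: P11 => _ _ _ [].
      by apply: run_skip; rewrite ?muln_gt0.
    move=> s12 [[b12 w12] r12 k12 [d12 m12] x12]; split=> //; split=> //; split=> //.
    by move=> x xm; rewrite x12 //; case: ltngtP => // ->.
  + by move=> s7 _ [[bs7 s7r s7d s7m s7x] s7w]; split.
- apply: (run_assign (v := wt (f j))) => //; split=> //; split=> //.
  exact: same_regs_trans s5r (same_regs_set _ _ _).
Qed.

End Steps.

(** The branches realize [gauss_inv_odd], [gauss_inv_hyperbolic] and [gauss_inv_radical], in this
    order. *)
Definition gauss_step : cmd :=
  Seq find_pivot
  (If (Op OLt (Reg 3) (Reg 0))
     (Seq eliminate_rows
        (If (Op OEq (Reg 3) (Reg 2))
           (Seq (Assign 5 (Op OAdd (Reg 5) (Const 1)))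
                (Assign 4 (Op OMod (Op OAdd (Op OAdd (Reg 4)
                   (Op OMul (Const 3) (Op OMod (Reg 10) (Const 4)))) (Const 6)) (Const 8))))
           (Seq (Assign 5 (Op OAdd (Reg 5) (Const 2)))
                (Assign 4 (Op OMod (Op OAdd (Reg 4)
                   (Op OMul (Op OMod (Reg 10) (Const 4)) (Reg 11))) (Const 8))))))
     (If (Op OEq (Op OMod (Reg 10) (Const 4)) (Const 2)) (Assign 6 (Const 0)) Skip)).

(** By [gauss_inv_end] the dimension of the radical and the exponent of the square root of 2 are the
    same number, hence the copy of register 3 into register 5. *)
Definition tutte_program : cmd :=
  Seq (Assign 4 (Op OMod (Op OAdd (Op OMul (Const 6) (Reg 1)) (Op OMul (Const 3) (Reg 0)))
         (Const 8)))
  (Seq (Assign 6 (Const 1))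
  (Seq (loop 2 (Reg 0) gauss_step)
  (Seq (Assign 3 (Op OSub (Reg 0) (Reg 5)))
  (Seq (Assign 5 (Reg 3))
  (Seq (Assign 2 (Op OSub (Reg 1) (Reg 0)))
       (Assign 0 (Reg 6))))))).

Lemma eq_gauss_inv (E : finType) (V : {vspace binvec E}) m f g a k z :
  (forall x, x < m -> f x = g x) -> gauss_inv V m f a k z -> gauss_inv V m g a k z.
Proof. by move=> fg inv R; rewrite inv (eq_comb_sum _ _ fg). Qed.

(** * Correctness and running time of the program *)

Section Program.
Variables (E : finType) (V : {vspace binvec E}) (w : nat).
Local Notation n := #|E|.
Local Notation d := (\dim V).
Hypothesis word_size : 100 * (d.+1 * n.+1) <= 2 ^ w.
Implicit Types (s : state).

(** Register 5 grows by at most 2 per row; its bound excludes overflow. *)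
Definition step_inv (m : nat) s : Prop :=
  [/\ [/\ reg s 0 = d, reg s 1 = n & bits s], reg s 4 < 8, reg s 5 <= 2 * (d - m),
      reg s 6 <= 1 & gauss_inv V m (row E s) (reg s 5) (reg s 4) (reg s 6)].

Lemma dim_le : d <= n.
Proof. by rewrite -(rank_setT V) leq_addl. Qed.

Let const k : k < 100 -> k %% 2 ^ w = k := @small_const E w d word_size k.
Let lin k : k < 50 * (d + n) -> k %% 2 ^ w = k := @small_lin E w d word_size k.

Lemma run_gauss_step s m : step_inv m.+1 s -> reg s 2 = m -> m < d ->
  run w gauss_step s (fun s' => reg s' 2 = m /\ step_inv m s') (500 * (d * n)).
Proof.
move=> [[s0 s1 bs] s4 s5 s6 inv] s2 md.
have d_gt0 : 0 < d by apply: leq_ltn_trans md.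
have n_gt0 : 0 < n by apply: leq_trans dim_le.
have dn_gt0 : 0 < d * n by rewrite muln_gt0 d_gt0.
pose f := row E s; pose v := f m.
apply: (run_seq (run_find_pivot word_size n_gt0 bs s0 s1 s2 md) (B2 := 400 * (d * n)));
    last by lia.
move=> p [pm pr p10 piv].
have wt_le (u : binvec E) : wt u <= n by apply: max_card.
have wt4 : wt v %% 4 < 4 by rewrite ltn_mod.
have bp : bits p by move=> a; rewrite pm.
have evb (b : bool) : b %% 2 ^ w = b by case: b; apply: const.
have evlt : eval w p (Op OLt (Reg 3) (Reg 0)) = (reg p 3 < d).
  by rewrite /= (pr 0) // s0 evb.
have jd : reg p 3 < d -> odd (wt v) /\ reg p 3 = m \/
    [/\ ~~ odd (wt v), reg p 3 < m & odd (ndot v (f (reg p 3)))].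
  case: piv => [pv|pv|[-> _]] h; [by left|by right; exact: pv|by rewrite ltnn in h].
apply: (@run_leq _ _ _ _ (3 + 350 * (d * n)).+1); last by nia.
apply: (run_if evlt).
case: ltnP => [/[dup] jltd {}/jd jd|dj] /=.
  have [pp0 pp1 pp2] : [/\ reg p 0 = d, reg p 1 = n & reg p 2 = m] by rewrite !pr.
  apply: (run_seq (run_eliminate_rows word_size n_gt0 bp pp0 pp1 pp2 erefl md jltd) (B2 :=
      40)); last first; [move: (d * n) dn_gt0 => x; lia|].
  move=> q [bq qr q11 qx].
  have {}qx x : x < m -> row E q x = eliminate v (f (reg p 3)) (f x).
    by move=> /qx ->; rewrite !(eq_row _ pm).
  have {}q11 : reg q 11 = wt (f (reg p 3)) by rewrite q11 (eq_row _ pm).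
  have q10 : reg q 10 = wt v by rewrite qr.
  have [q0 q1] : reg q 0 = d /\ reg q 1 = n by rewrite !qr.
  have q2 : reg q 2 = m by rewrite qr.
  have [[q3 q4] [q5 q6]] : (reg q 3 = reg p 3 /\ reg q 4 = reg s 4) /\ (reg q 5 = reg s 5 /\
      reg q 6 = reg s 6).
    by rewrite !(qr 3, qr 4, qr 5, qr 6) // (pr 4) // (pr 5) // (pr 6).
  have eveq : eval w q (Op OEq (Reg 3) (Reg 2)) = (reg p 3 == m).
    by rewrite /= q3 q2 evb.
  apply: (@run_leq _ _ _ _ (3 + 30).+1); last by [].
apply: (run_if eveq).
  case: jd => [[wo jm]|[we jm vu]].
    rewrite jm eqxx /=; rewrite jm in qx.
    apply: (@run_seq _ (fun s' => s' = set_reg q 5 (reg s 5).+1) _ _ _ _ 4 26) => //.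
      by apply: (run_assign (v := (reg s 5).+1)) => //=; rewrite q5 (const (k := 1)) // addn1
          lin //; lia.
    move=> _ ->.
    apply: (run_assign (v := (reg s 4 + 3 * (wt v %% 4) + 6) %% 8)) => //.
      rewrite /= /upd /= q4 q10 (const (k := 3)) // (const (k := 4)) // (const (k := 6)) //.
      rewrite (const (k := 8)) // (const (k := wt v %% 4)); last by lia.
      rewrite (const (k := 3 * _)); last by lia.
      rewrite (const (k := reg s 4 + _)); last by lia.
      rewrite (const (k := _ + 6)); last by lia.
      by rewrite const // (ltn_trans (ltn_pmod _ _)).
    rewrite /step_inv /= /upd /=; split=> //; split=> //.
    - by rewrite ltn_mod.
    - lia.
    - by rewrite q6.
    by rewrite q6; apply: gauss_inv_odd inv wo _.
  rewrite (ltn_eqF jm) /=.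
  apply: (@run_seq _ (fun s' => s' = set_reg q 5 (reg s 5).+2) _ _ _ _ 4 26) => //.
    by apply: (run_assign (v := (reg s 5).+2)) => //=; rewrite q5 (const (k := 2)) // addn2 lin
        //; lia.
  move=> _ ->; set u := f (reg p 3).
  (* This bound, linear in [n], keeps the product within a word. *)
  have mul_le : wt v %% 4 * wt u <= 3 * n by apply: leq_mul => //; lia.
  apply: (run_assign (v := (reg s 4 + wt v %% 4 * wt u) %% 8)) => //.
    rewrite /= /upd /= q4 q10 q11 -/u (const (k := 4)) // (const (k := 8)) //.
    rewrite (const (k := wt v %% 4)); last by lia.
    rewrite (lin (k := _ * _)); last by lia.
    rewrite (lin (k := _ + _)); last by lia.
    by rewrite const // (ltn_trans (ltn_pmod _ _)).
  rewrite /step_inv /= /upd /=; split=> //; split=> //.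
  - by rewrite ltn_mod.
  - lia.
  - by rewrite q6.
  by rewrite q6; apply: gauss_inv_hyperbolic inv jm we vu _.
have none x : x <= m -> ~~ odd (ndot (f x) v).
  case: piv => [[_ jm]|[_ jm _]|[_ no]]; last exact: no.
    by move: dj; rewrite jm leqNgt md.
  by move: dj; rewrite leqNgt (ltn_trans jm md).
have evw : eval w p (Op OEq (Op OMod (Reg 10) (Const 4)) (Const 2)) = (wt v %% 4 == 2).
  by rewrite /= p10 -/v evb (const (k := 2)) // (const (k := 4)) // (const (k := wt v %% 4))
      //; lia.
apply: (@run_leq _ _ _ _ (5 + 3).+1); last by move: (d * n) dn_gt0 => x; lia.
apply: (run_if evw).
have := gauss_inv_radical inv none; rewrite -/v.
case: ifP => _ /= invm.
  apply: (run_assign (v := 0)) => //=; first by rewrite const.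
  rewrite /step_inv /= /upd /= !pr //; split=> //; split=> //; first lia.
  by apply: eq_gauss_inv invm => x _; rewrite -(eq_row _ pm).
apply: run_skip => //; rewrite /step_inv !pr //; split=> //; split=> //; first lia.
by apply: eq_gauss_inv invm => x _; rewrite (eq_row _ pm).
Qed.

(** For [x] beyond the last vector both sides default to 0. *)
Lemma nth_input (b : seq (binvec E)) x e :
  Defs.mem (input b) (x * n + enum_rank e) = (nth 0%R b x e != 0%R).
Proof.
have en : enum_rank e < n by apply: ltn_ord.
rewrite /=; elim: b x => [|v b IH] x /=; first by rewrite !nth_nil ffunE eqxx.
rewrite nth_cat size_map -cardE; case: x => [|x].
  rewrite mul0n add0n en (nth_map e) -?cardE ?en //=.
  by rewrite nth_enum_rank.
by rewrite mulSn -addnA ltnNge leq_addr /= addKn IH.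
Qed.

Lemma bits_input (b : seq (binvec E)) : bits (input b).
Proof.
move=> a /=; set l := flatten _.
have /allP l_le : all (fun k => k <= 1) l.
  rewrite /l; elim: b {l} => //= v b IH; rewrite all_cat IH andbT.
  by apply/allP => _ /mapP[e _ ->]; case: (_ != _).
by case: (ltnP a (size l)) => al; [apply/l_le/mem_nth | rewrite nth_default].
Qed.

Lemma run_tutte_program (b : seq (binvec E)) : basis_of V b ->
  run w tutte_program (input b)
    (fun s => forall R : realType, output_value V (tutte_value R V) s)
    (1000 * (d ^ 2 * n + 1)).
Proof.
move=> bV; have size_b : size b = d by case/andP: (bV) => /eqP <- /eqP.
have rank_n : rank (space_matroid V) [set: E] = n - d by rewrite -(rank_setT V) addnK.
pose s0 := set_reg (input b) 4 ((6 * n + 3 * d) %% 8).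
apply: (@run_seq _ (fun s => s = s0) _ _ _ _ 10 (990 * (d ^ 2 * n + 1))); last by lia.
  apply: (run_assign (v := (6 * n + 3 * d) %% 8)) => //=; rewrite size_b !(const (k := 6),
      const (k := 3), const (k := 8)) //.
  (* The strict bound in [lin] is void when [d + n = 0]. *)
  case: (posnP (d + n)) => [|dn].
    by move/eqP; rewrite addn_eq0 => /andP[/eqP -> /eqP ->]; rewrite !(muln0, mod0n).
  rewrite (lin (k := 6 * n)); last by lia.
  rewrite (lin (k := 3 * d)); last by lia.
  rewrite (lin (k := _ + _)); last by lia.
  by rewrite const // (ltn_trans (ltn_pmod _ _)).
move=> _ ->; pose s1 := set_reg s0 6 1.
apply: (@run_seq _ (fun s => s = s1) _ _ _ _ 2 (980 * (d ^ 2 * n + 1))); last by lia.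
  by apply: (run_assign (v := 1)) => //=; rewrite const.
move=> _ ->.
apply: (@run_seq _ (step_inv 0) _ _ _ _ (1 + d * (500 * (d * n) + 6) + 3) 30); last first.
- have := dim_le; case: (posnP d) => [->|d_gt0 dn]; first by lia.
  (* Since [0 < d <= n], the loop overhead is absorbed by [d ^ 2 * n]. *)
  have h : d * 6 <= 6 * (d ^ 2 * n) by nia.
  have -> : d * (500 * (d * n) + 6) = 500 * (d ^ 2 * n) + d * 6 by ring.
  lia.
- move=> s [[r0 r1 bs] r4 r5 r6 inv].
  have H := gauss_inv_end r6 inv.
  pose r := d - reg s 5.
  have rE : r %% 2 ^ w = r by rewrite modn_small //; apply: leq_trans word_size; rewrite /r; nia.
  have nE : (n - d) %% 2 ^ w = n - d by rewrite modn_small //; apply: leq_trans word_size; nia.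
  apply: (@run_seq _ (fun s' => s' = set_reg s 3 r) _ _ _ _ 4 20) => //.
    by apply: (run_assign (v := r)) => //=; rewrite r0.
  move=> _ ->.
  apply: (@run_seq _ (fun s' => s' = set_reg (set_reg s 3 r) 5 r) _ _ _ _ 2 15) => //.
    by apply: (run_assign (v := r)).
  move=> _ ->.
  apply: (@run_seq _ (fun s' => s' = set_reg (set_reg (set_reg s 3 r) 5 r) 2 (n - d)) _ _ _ _ 4
      10) => //.
    by apply: (run_assign (v := n - d)) => //=; rewrite /upd /= r0 r1.
  move=> _ ->.
  apply: (run_assign (v := reg s 6)) => // R.
  have [z0 zR] := H R; rewrite /output_value /= /upd /=; split=> // /zR[rad val].
  by split.
- apply: (run_loop (I := step_inv)) => //.
  + exact: word_gt1 word_size.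
  + by apply: leq_trans word_size; nia.
  + rewrite /step_inv /= /upd /= size_b; split=> //.
    * by split=> //; apply: bits_input.
    * by rewrite ltn_mod.
    * apply: gauss_inv_init bV _ => x xd.
      apply/ffunP => e; rewrite ffunE nth_input.
      by rewrite [RHS]F2_natr.
  + move=> k s kd inv sk; by apply: run_gauss_step => //=; rewrite /upd eqxx.
Qed.

End Program.

(* The additive constant only matters when dim V = 0 or E is empty. The word
   size is only assumed to be at least log2 (dim V * |E|) up to a constant. *)
Theorem theorem6 :
  exists (p : cmd) (C K : nat),
  forall (E : finType) (V : {vspace binvec E}) (b : seq (binvec E)) (w : nat),
    basis_of V b ->
    (K * ((\dim V).+1 * #|E|.+1) <= 2 ^ w)%N ->
    exists (s : state) (t : nat),
      [/\ exec w p (input b) s t,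
          (t <= C * (\dim V ^ 2 * #|E| + 1))%N &
          forall R : realType, output_value V (tutte_value R V) s].
Proof.
exists tutte_program, 1000, 100 => E V b w bV word_size.
have [s [t [ex le val]]] := run_tutte_program word_size bV.
by exists s, t; split.
Qed.
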